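(* Fix a cut and project scheme $(\mathbb{R}^n, \mathbb{R}^m, \mathcal{L})$ as described in the context. Let $W, W' \subset \mathbb{R}^m$ be windows (compact sets with $W=\overline{W^\circ}$, $W'=\overline{W'^\circ}$, non-empty interior, and boundaries of Lebesgue measure $0$), and let $\varLambda = t + \curlywedge(W)$ and $\varLambda' = t' + \curlywedge(W')$ for some $t,t'\in\mathbb{R}^n$ be the corresponding regular model sets. Then $\varLambda$ and $\varLambda'$ are homometric if and only if $W$ and $W'$ have the same covariogram, i.e. $g^{}_{W}(y) = g^{}_{W'}(y)$ for all $y \in \mathbb{R}^m$.
   Context: A cut and project scheme consists of $\mathbb{R}^n$ (direct space), $\mathbb{R}^m$ (internal space), the canonical projections $\pi:\mathbb{R}^n\times\mathbb{R}^m\to\mathbb{R}^n$ and $\pi_{\mathrm{int}}:\mathbb{R}^n\times\mathbb{R}^m\to\mathbb{R}^m$, and a lattice $\mathcal{L}\subset\mathbb{R}^{n+m}$ such that $\pi|_{\mathcal{L}}$ is injective and $L^\star := \pi_{\mathrm{int}}(\mathcal{L})$ is dense in $\mathbb{R}^m$. With $L=\pi(\mathcal{L})$, the $\star$-map $L\to L^\star$ is $x^\star = \pi_{\mathrm{int}}((\pi|_{\mathcal{L}})^{-1}(x))$. For a window $W\subset\mathbb{R}^m$, $\curlywedge(W) := \{x\in L \mid x^\star\in W\}$; a (regular) model set is $\varLambda = t+\curlywedge(W)$ with $t\in\mathbb{R}^n$ and $W$ compact, $W=\overline{W^\circ}$ with non-empty interior, and $\partial W$ of Lebesgue measure $0$.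 The covariogram of a compact set $K\subset\mathbb{R}^m$ is $g^{}_K(y) = \mathrm{vol}(K\cap(y+K))$. The autocorrelation of a Delone set $\varLambda\subset\mathbb{R}^n$ is the measure $\gamma^{}_\varLambda = \lim_{r\to\infty} \frac{1}{\mathrm{vol}(B_r)} \delta_{\varLambda\cap B_r} * \delta_{-\varLambda\cap B_r}$ (vague limit), where $B_r$ is the open ball of radius $r$ about $0$ and $\delta_S=\sum_{x\in S}\delta_x$; for model sets this limit exists (and is independent of the averaging van Hove sequence). Two Delone sets are called homometric if they have the same autocorrelation measure. *)

(* Defs.v *)
(* R^k is modelled as 'rV[R]_k,
   and R^(n+m) = R^n x R^m via lsubmx / rsubmx. *)
From HB Require Import structures.
From mathcomp Require Import all_boot all_order all_algebra.
From mathcomp Require Import all_classical all_reals all_analysis.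
Set Implicit Arguments. Unset Strict Implicit. Unset Printing Implicit Defensive.
Import Order.TTheory GRing.Theory Num.Theory.
Import numFieldNormedType.Exports.
Local Open Scope classical_set_scope.
Local Open Scope ring_scope.

Section Defs.
Variable R : realType.

Definition box (k : nat) (a b : 'rV[R]_k) : set 'rV[R]_k :=
  [set x | forall i : 'I_k, a ord0 i <= x ord0 i /\ x ord0 i < b ord0 i].

Definition box_vol (k : nat) (a b : 'rV[R]_k) : R :=
  \prod_(i < k) Num.max 0 (b ord0 i - a ord0 i).

(* Lebesgue outer measure on R^k: infimum of the total volumes of countable
   covers by boxes.  On Lebesgue measurable sets (compact sets, ...) this is
   the Lebesgue measure vol. *)
Definition leb_vol (k : nat) (A : set 'rV[R]_k) : \bar R :=
  ereal_inf [set (\sum_(0 <= j <oo) (box_vol (ab.1 j) (ab.2 j))%:E)%E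
            | ab in [set ab : (nat -> 'rV[R]_k) * (nat -> 'rV[R]_k) |
                     A `<=` \bigcup_j box (ab.1 j) (ab.2 j)]].

Definition lattice (n m : nat) (B : 'M[R]_(n + m)) : set 'rV[R]_(n + m) :=
  [set map_mx (fun k : int => k%:~R) z *m B | z in [set: 'rV[int]_(n + m)]].

(* pi = lsubmx (direct space R^n), pi_int = rsubmx (internal space R^m) *)
Definition cut_project_scheme (n m : nat) (B : 'M[R]_(n + m)) : Prop :=
  [/\ B \in unitmx,
      (forall x y, lattice B x -> lattice B y -> lsubmx x = lsubmx y -> x = y)
    & dense [set rsubmx z | z in lattice B]].

Definition window (m : nat) (W : set 'rV[R]_m) : Prop :=
  [/\ compact W, closure (interior W) = W, interior W !=set0
    & leb_vol (closure W `\` interior W) = 0%E].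

(* t + curlywedge(W) = { t + x | x in L, x^* in W } where x = pi z, x^* = pi_int z *)
Definition model_set (n m : nat) (B : 'M[R]_(n + m)) (t : 'rV[R]_n)
  (W : set 'rV[R]_m) : set 'rV[R]_n :=
  [set t + lsubmx z | z in [set z | lattice B z /\ W (rsubmx z)]].

Definition covariogram (m : nat) (K : set 'rV[R]_m) (y : 'rV[R]_m) : \bar R :=
  leb_vol (K `&` [set y + x | x in K]).

Definition eball (n : nat) (r : R) : set 'rV[R]_n :=
  [set x | Num.sqrt (\sum_(i < n) x ord0 i ^+ 2) < r].

(* (1/vol(B_r)) (delta_{Lam /\ B_r} * delta_{-Lam /\ B_r}) tested against f *)
Definition autocorr_approx (n : nat) (Lam : set 'rV[R]_n)
  (f : 'rV[R]_n -> R) (r : R) : R :=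
  (\sum_(x \in Lam `&` @eball n r)
     \sum_(y \in [set - z | z in Lam] `&` @eball n r) f (x + y))
  / fine (leb_vol (@eball n r)).

Definition Cc (n : nat) (f : 'rV[R]_n -> R) : Prop :=
  continuous f /\ compact (closure [set x | f x != 0]).

(* Homometric: the vague limits (as r -> oo) of the approximants of both sets
   exist and coincide, i.e. both converge vaguely to one common measure gamma,
   represented by its action on C_c. *)
Definition homometric (n : nat) (Lam Lam' : set 'rV[R]_n) : Prop :=
  exists gamma : ('rV[R]_n -> R) -> R,
    forall f, Cc f ->
      autocorr_approx Lam f r @[r --> +oo] --> gamma f /\
      autocorr_approx Lam' f r @[r --> +oo] --> gamma f.

End Defs.

(* Main.v *)
Require Import Defs.
From HB Require Import structures.
From mathcomp Require Import all_boot all_order all_algebra finmap.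
From mathcomp Require Import all_classical all_reals all_analysis.
From mathcomp Require Import ring lra.
Set Implicit Arguments. Unset Strict Implicit. Unset Printing Implicit Defensive.
Import Order.TTheory GRing.Theory Num.Theory.
Import numFieldNormedType.Exports.
Local Open Scope classical_set_scope.
Local Open Scope ring_scope.

(** Count lattice points. A cell is the set of lattice points in a product of a
    cube of side s in direct space and a cube of side h in internal space. Since
    the internal projections are dense and the lattice is cocompact, any cell
    can be moved by a lattice vector into any cell that is larger by a bounded
    amount in direct space and by an arbitrarily small amount in internal space.
    Combined with a Fekete-type subdivision this gives a constant c > 0 such that
    a cell has about c s^n h^m points, uniformly in its position. Packing balls
    and Jordan measurable windows by cubes then shows that
    #{z : pi(z) in B_r, pi_int(z) in K} / vol(B_r) tends to c vol(K).

    Grouping the pairs of points of the model set by their difference w, the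
    autocorrelation tested against f tends to
    c sum_w f(pi(w)) g_W(pi_int(w)), a finite sum over lattice points w because
    f has compact support and W - W is bounded. As pi is injective, bump
    functions f isolate the individual values of g_W on the dense set L*, and
    g_W is continuous. *)

(** * Counting *)

(** [fset_set] sends an infinite set to the empty one, so this is the cardinality only on finite
    sets; hence the finiteness hypotheses below. *)
Definition cnt (T : choiceType) (A : set T) : nat := #|` fset_set A|.

Section Counting.
Variables (T U : choiceType).

Lemma cnt_le (A B : set T) : finite_set B -> A `<=` B -> (cnt A <= cnt B)%N.
Proof.
move=> fB AB; apply: fsubset_leq_card.
by rewrite -fset_set_sub //; exact: sub_finite_set AB fB.
Qed.

Lemma cnt_sum (A B : set T) : finite_set B -> A `<=` B ->
  cnt A = (\sum_(x <- fset_set B) (x \in A))%N.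
Proof.
move=> fB AB; have fA := sub_finite_set AB fB.
rewrite -big_mkcond sum1_count -size_filter.
apply/perm_size/uniq_perm; rewrite ?fset_uniq ?filter_uniq //.
move=> x; rewrite mem_filter !in_fset_set //.
apply/idP/andP => [xA|[]//]; split=> //.
by rewrite inE; apply: AB; rewrite inE in xA.
Qed.

Lemma cnt_inj (A : set T) (B : set U) (f : T -> U) : injective f ->
  finite_set B -> (forall x, A x -> B (f x)) -> finite_set A /\ (cnt A <= cnt B)%N.
Proof.
move=> fI fB AB.
have fA : finite_set A.
  have : finite_set (f @^-1` B).
    by apply: finite_preimage => // x y _ _; exact: fI.
  by apply: sub_finite_set.
split=> //; have -> : cnt A = cnt (f @` A).
  by rewrite /cnt fset_set_image // card_imfset.
have fAB : f @` A `<=` B by move=> _ [x Ax <-]; exact: AB.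
apply: fsubset_leq_card; rewrite -fset_set_sub //.
exact: sub_finite_set fAB fB.
Qed.

(** Count the pairs (x, i) with [x] in both [X] and [Y i], and exchange the two sums: each point of
    [X] lies in at least one pair. *)
Lemma cnt_ub (I : set U) (Y : U -> set T) (X : set T) (k : nat) :
  finite_set I -> finite_set X ->
  (forall x, X x -> exists2 i, I i & Y i x) ->
  (forall i, I i -> (cnt (X `&` Y i) <= k)%N) ->
  (cnt X <= cnt I * k)%N.
Proof.
move=> fI fX XY Yk.
rewrite [cnt X](cnt_sum fX (@subset_refl _ X)).
apply: (@leq_trans (\sum_(x <- fset_set X) \sum_(i <- fset_set I) (x \in X `&` Y i))%N).
  rewrite big_seq [X in (_ <= X)%N]big_seq; apply: leq_sum => x.
  rewrite in_fset_set // => xX.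
  have [|i Ii Yx] := XY x; first by rewrite inE in xX.
  rewrite xX (big_fsetD1 i) /=; last by rewrite in_fset_set // inE.
  by rewrite mem_set //; split=> //; exact: set_mem.
rewrite exchange_big /= /cnt -sum1_size big_distrl /=.
rewrite big_seq [X in (_ <= X)%N]big_seq; apply: leq_sum => i.
rewrite in_fset_set // inE mul1n => Ii.
by rewrite -cnt_sum //; exact: Yk.
Qed.

(** The same double count; disjointness of the [Y i] makes every point of [X] occur in at most one
    pair. *)
Lemma cnt_lb (I : set U) (Y : U -> set T) (X : set T) (k : nat) :
  finite_set I -> finite_set X ->
  (forall i, I i -> Y i `<=` X) ->
  (forall i j x, I i -> I j -> Y i x -> Y j x -> i = j) ->
  (forall i, I i -> (k <= cnt (Y i))%N) ->
  (cnt I * k <= cnt X)%N.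
Proof.
move=> fI fX YX Yd kY.
rewrite {1}/cnt -sum1_size big_distrl /=.
apply: (@leq_trans (\sum_(i <- fset_set I) \sum_(x <- fset_set X) (x \in Y i))%N).
  rewrite big_seq [X in (_ <= X)%N]big_seq; apply: leq_sum => i.
  rewrite in_fset_set // inE mul1n => Ii.
  by rewrite -cnt_sum //; [exact: kY|exact: YX].
rewrite exchange_big /= /cnt -[X in (_ <= X)%N]sum1_size.
apply: leq_sum => x _.
have [[i Ii Yx]|nY] := pselect (exists2 i, I i & Y i x).
  rewrite (big_fsetD1 i) /=; last by rewrite in_fset_set // inE.
  rewrite big_seq big1 ?addn0 ?leq_b1 //.
  move=> j; rewrite !inE in_fset_set // => /andP[ji /set_mem Ij].
  apply/eqP; rewrite eqb0; apply/negP => /set_mem Yj.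
  by move: ji; rewrite (Yd _ _ _ Ij Ii Yj Yx) eqxx.
rewrite big_seq big1 // => i; rewrite in_fset_set // => /set_mem Ii.
by apply/eqP; rewrite eqb0; apply/negP => /set_mem Yi; apply: nY; exists i.
Qed.

(** A natural number is at most [v] iff it is at most the truncation of [v]; the lower bound that
    follows rounds up instead. *)
Lemma cnt_ubr (R : realType) (I : set U) (Y : U -> set T) (X : set T) (v : R) :
  0 <= v -> finite_set I -> finite_set X ->
  (forall x, X x -> exists2 i, I i & Y i x) ->
  (forall i, I i -> (cnt (X `&` Y i))%:R <= v) ->
  (cnt X)%:R <= (cnt I)%:R * v.
Proof.
move=> v0 fI fX XY Yv.
have : (cnt X <= cnt I * Num.truncn v)%N.
  by apply: (cnt_ub fI fX XY) => i /Yv; rewrite truncn_ge_nat.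
rewrite -(ler_nat R) natrM => /le_trans; apply.
by rewrite ler_wpM2l // truncn_le.
Qed.

Lemma cnt_lbr (R : realType) (I : set U) (Y : U -> set T) (X : set T) (v : R) :
  0 <= v -> finite_set I -> finite_set X ->
  (forall i, I i -> Y i `<=` X) ->
  (forall i j x, I i -> I j -> Y i x -> Y j x -> i = j) ->
  (forall i, I i -> v <= (cnt (Y i))%:R) ->
  (cnt I)%:R * v <= (cnt X)%:R.
Proof.
move=> v0 fI fX YX Yd vY.
have c0 : 0 <= Num.ceil v by rewrite ceil_ge0; exact: lt_le_trans v0.
have : (cnt I * `|Num.ceil v| <= cnt X)%N.
  apply: (cnt_lb fI fX YX Yd) => i /vY.
  by rewrite -lez_nat gez0_abs // ceil_le_int.
rewrite -(ler_nat R) natrM; apply: le_trans.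
by rewrite ler_wpM2l // natr_absz ger0_norm // ceil_ge.
Qed.

Lemma cnt_bigcup_seq (s : seq U) (Y : U -> set T) (X : set T) :
  finite_set X -> (forall x, X x -> exists2 i, i \in s & Y i x) ->
  (forall i, finite_set (Y i)) ->
  (cnt X <= \sum_(i <- s) cnt (Y i))%N.
Proof.
move=> fX XY fY.
rewrite (cnt_sum fX (@subset_refl _ X)).
apply: (@leq_trans (\sum_(x <- fset_set X) \sum_(i <- s) (x \in X `&` Y i))%N).
  rewrite big_seq [X in (_ <= X)%N]big_seq; apply: leq_sum => x.
  rewrite in_fset_set // => xX.
  have [|i Ii Yx] := XY x; first by rewrite inE in xX.
  rewrite xX (big_rem i) //=.
  by rewrite mem_set //; split=> //; exact: set_mem.
rewrite exchange_big /=; apply: leq_sum => i _.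
rewrite -cnt_sum //.
by apply: cnt_le (fY _) _; exact: subIsetr.
Qed.

Lemma cntU_le (A B C : set T) : finite_set B -> finite_set C -> A `<=` B `|` C ->
  (cnt A <= cnt B + cnt C)%N.
Proof.
move=> fB fC /cnt_le -/(_ _)/leq_trans; apply; first by rewrite finite_setU.
by rewrite /cnt fset_setU // cardfsU leq_subr.
Qed.

Lemma cnt_setX (A : set T) (B : set U) : finite_set A -> finite_set B ->
  cnt (A `*` B) = (cnt A * cnt B)%N.
Proof.
move=> fA fB; rewrite /cnt -(size_allpairs (fun x y => (x, y))).
apply/perm_size/uniq_perm; rewrite ?fset_uniq //.
  by apply: allpairs_uniq; rewrite ?fset_uniq // => -[a b] [c d] _ _ /=.
move=> [x y]; rewrite in_fset_set; last exact: finite_setX.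
apply/idP/allpairsP => [/set_mem[/= Ax By]|[[a b] [/= aA bB [-> ->]]]].
  by exists (x, y); split=> //=; rewrite in_fset_set // inE.
by rewrite inE; split=> /=; apply/set_mem; rewrite -in_fset_set.
Qed.

End Counting.

Definition int_box k (lo : 'I_k -> int) (len : 'I_k -> nat) : set 'rV[int]_k :=
  [set a | forall i, lo i <= a ord0 i < lo i + (len i)%:Z].

(** The offsets from the lower corner form a dependent product of ordinals, whose cardinality is
    known. *)
Lemma int_box_cnt k (lo : 'I_k -> int) (len : 'I_k -> nat) :
  finite_set (int_box lo len) /\ cnt (int_box lo len) = (\prod_i len i)%N.
Proof.
pose F i : pred 'I_(len i) := predT.
pose f (g : {dffun forall i, 'I_(len i)}) : 'rV[int]_k :=
  \row_i (lo i + (g i : nat)%:Z).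
have fI : injective f.
  move=> g1 g2 /rowP e; apply/ffunP => i; apply/val_inj.
  by have := e i; rewrite !mxE => /addrI [].
have E : int_box lo len = f @` [set: {dffun forall i, 'I_(len i)}].
  apply/seteqP; split=> [a /= aP|_ [g _ <-] i]; last first.
    by rewrite mxE lerDl ltrD2l /= ltz_nat ltn_ord.
  have H i : (`|a ord0 i - lo i| < len i)%N.
    have /andP[l1 l2] := aP i.
    by rewrite -ltz_nat gez0_abs ?subr_ge0 // ltrBlDl.
  exists [ffun i => Ordinal (H i)] => //.
  apply/rowP => i; rewrite mxE ffunE /= gez0_abs ?subrKC //.
  by rewrite subr_ge0; have /andP[] := aP i.
have fT : finite_set [set: {dffun forall i, 'I_(len i)}] by exact: finite_finset.
split; first by rewrite E; exact: finite_image.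
rewrite E /cnt fset_set_image // card_imfset //=.
have -> : size (fset_set [set: {dffun forall i, 'I_(len i)}]) = #|{dffun forall i,
  'I_(len i)}|.
  rewrite cardE; apply/perm_size/uniq_perm; rewrite ?fset_uniq ?enum_uniq //.
  by move=> x; rewrite in_fset_set // mem_enum mem_set.
by rewrite card_dep_ffun foldrE big_map big_enum /=; apply: eq_bigr => i _; rewrite card_ord.
Qed.

(** * Packing of boxes *)

Section Packing.
Variables (R : realType) (k : nat).
Implicit Types (a b x : 'rV[R]_k).

Lemma box_vol_ge0 a b : 0 <= box_vol a b.
Proof. by apply: prodr_ge0 => i _; rewrite le_max lexx. Qed.

(** Error terms throughout are polynomials in a small parameter; continuity at 0 then replaces
    explicit estimates. *)
Lemma poly_lt_near0 (p : {poly R}) (v : R) : p.[0] < v ->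
  exists2 e, 0 < e & forall e', 0 < e' <= e -> p.[e'] < v.
Proof.
move=> pv; have := @continuous_horner _ p 0.
move=> /cvgr_lt /(_ _ pv) /nbhs_ballP[e /= e0 pe].
exists (e / 2); first by rewrite divr_gt0.
move=> e' /andP[e'0 e'e]; apply: pe; rewrite /ball /= sub0r normrN gtr0_norm //.
by apply: le_lt_trans e'e _; rewrite ltr_pdivrMr // mulr_natr mulr2n ltrDl.
Qed.

Lemma poly_ge_harmonic (p : {poly R}) (v : R) :
  (forall q : nat, v <= p.[q.+1%:R^-1]) -> v <= p.[0].
Proof.
move=> H; rewrite leNgt; apply/negP => /poly_lt_near0[e e0 pe].
have := pe (Num.truncn e^-1).+1%:R^-1; rewrite invr_gt0 ltr0n /=.
rewrite -[e in _^-1 <= e]invrK lef_pV2 ?posrE ?invr_gt0 ?ltr0n // ltW ?truncnS_gt //.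
by move=> /(_ isT); rewrite ltNge H.
Qed.

Let q_ (q : nat) : R := q.+1%:R.
Let grid (q : nat) (a b : 'rV[R]_k) : set 'rV[int]_k :=
  [set z | box a b (\row_i ((z ord0 i)%:~R / q_ q))].

Let q_gt0 q : 0 < q_ q. Proof. by rewrite /q_ ltr0n. Qed.

Let lo q a i := Num.ceil (a ord0 i * q_ q).
Let len q a b i : nat := absz (Num.max 0 (lo q b i - lo q a i)).

(** Boxes are half-open, so both ends round the same way: z / (q+1) lies in [a, b) iff z lies
    between the ceilings of a (q+1) and b (q+1), the latter excluded. *)
Let gridE q a b : grid q a b = int_box (lo q a) (len q a b).
Proof.
have E (u v w : R) (z : int) : 0 < w ->
   (u <= z%:~R / w /\ z%:~R / w < v) <->
   (Num.ceil (u * w) <= z < Num.ceil (u * w) +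
      (absz (Num.max 0 (Num.ceil (v * w) - Num.ceil (u * w))))%:Z).
  move=> w0; rewrite ler_pdivlMr // ltr_pdivrMr //.
  rewrite ceil_le_int gez0_abs ?le_max ?lexx // addr_maxr addr0 subrKC lt_max.
  have -> : (z%:~R < v * w) = (z < Num.ceil (v * w)) by rewrite [RHS]ltNge ceil_le_int -ltNge.
  split=> [[-> ->]|/andP[]]; first by rewrite orbT.
  move=> h1 /orP[|-> //]; rewrite ltNge ceil_le_int h1 //.
by apply/seteqP; split=> z H i; move: (H i); rewrite mxE; move=> ?; apply/E.
Qed.

Let len_ub q a b i : (len q a b i)%:R <= Num.max 0 (b ord0 i - a ord0 i) * q_ q + 1.
Proof.
rewrite natr_absz ger0_norm ?le_max ?lexx //.
have /andP[h1 h2] := ceil_itv (b ord0 i * q_ q).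
have /andP[h3 h4] := ceil_itv (a ord0 i * q_ q).
move: h1 h2 h3 h4; rewrite /lo; set u := Num.ceil (b ord0 i * q_ q); set v
  := Num.ceil (a ord0 i * q_ q).
rewrite !intrD => h1 h2 h3 h4; have q0 := q_gt0 q.
rewrite maxr_pMl ?(ltW q0) // mul0r mulrBl.
have : b ord0 i * q_ q - a ord0 i * q_ q <= Num.max 0 (b ord0 i * q_ q - a ord0 i * q_ q).
  by rewrite le_max lexx orbT.
have : 0 <= Num.max 0 (b ord0 i * q_ q - a ord0 i * q_ q) by rewrite le_max lexx.
by case: (leP 0 (u - v)) => h5; rewrite ?rmorphB /=; lra.
Qed.

Let len_lb q a b i : (b ord0 i - a ord0 i) * q_ q - 1 <= (len q a b i)%:R.
Proof.
rewrite natr_absz ger0_norm ?le_max ?lexx //.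
have /andP[h1 h2] := ceil_itv (b ord0 i * q_ q).
have /andP[h3 h4] := ceil_itv (a ord0 i * q_ q).
move: h1 h2 h3 h4; rewrite /lo; set u := Num.ceil (b ord0 i * q_ q); set v
  := Num.ceil (a ord0 i * q_ q).
rewrite !intrD => h1 h2 h3 h4; have q0 := q_gt0 q.
rewrite mulrBl.
have : (u - v)%:~R <= (Num.max 0 (u - v))%:~R :> R by rewrite ler_int le_max lexx orbT.
rewrite rmorphB /=; lra.
Qed.

Let grid_finite q a b : finite_set (grid q a b).
Proof. by rewrite gridE; have [] := int_box_cnt (lo q a) (len q a b). Qed.

Let grid_ub q a b : (cnt (grid q a b))%:R <=
   \prod_i (Num.max 0 (b ord0 i - a ord0 i) + (q_ q)^-1) * q_ q ^+ k.
Proof.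
rewrite gridE; have [_ ->] := int_box_cnt (lo q a) (len q a b).
rewrite natr_prod -[X in q_ q ^+ X]card_ord -prodr_const -big_split /=.
apply: ler_prod => i _; rewrite ler0n /=; apply: le_trans (len_ub _ _ _ _) _.
by rewrite mulrDl mulVf ?gt_eqF // q_gt0.
Qed.

Let grid_lb q a (l : R) : (q_ q)^-1 <= l ->
  (l - (q_ q)^-1) ^+ k * q_ q ^+ k <= (cnt (grid q a (a + const_mx l)))%:R.
Proof.
move=> ql; rewrite gridE; have [_ ->] := int_box_cnt (lo q a) (len q a (a + const_mx l)).
rewrite natr_prod -exprMn -[X in _ ^+ X]card_ord -prodr_const.
have q0 := q_gt0 q.
apply: ler_prod => i _; rewrite mulr_ge0 ?subr_ge0 ?(ltW q0) //=.
apply: le_trans (len_lb _ _ _ _).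
by rewrite !mxE mulrBl mulVf ?gt_eqF // addrAC subrr add0r.
Qed.

(* Count the points of a fine grid in both unions and let the mesh tend to 0. *)
Lemma packing (U : choiceType) (I : set U) (c : U -> 'rV[R]_k) (l : R)
    (bs : seq ('rV[R]_k * 'rV[R]_k)) :
  finite_set I -> 0 < l ->
  (forall i j x, I i -> I j -> box (c i) (c i + const_mx l) x ->
     box (c j) (c j + const_mx l) x -> i = j) ->
  (forall i x, I i -> box (c i) (c i + const_mx l) x ->
     exists2 ab, ab \in bs & box ab.1 ab.2 x) ->
  (cnt I)%:R * l ^+ k <= \sum_(ab <- bs) box_vol ab.1 ab.2.
Proof.
move=> fI l0 disj cov.
(* At mesh [e] this is the lower bound for the cubes minus the upper bound for the cover, both
   divided by the number of grid points per unit volume. Its value at 0 is the difference of the two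
   volumes. *)
pose p : {poly R} := (cnt I)%:R%:P * (l%:P - 'X) ^+ k -
  \sum_(ab <- bs) \prod_i ((Num.max 0 (ab.2 ord0 i - ab.1 ord0 i))%:P + 'X).
have pE e : p.[e] = (cnt I)%:R * (l - e) ^+ k -
  \sum_(ab <- bs) \prod_i (Num.max 0 (ab.2 ord0 i - ab.1 ord0 i) + e).
  rewrite /p !hornerE horner_sum; congr (_ - _).
  by apply: eq_bigr => ab _; rewrite horner_prod; apply: eq_bigr => i _; rewrite !hornerE.
have pq q : (q_ q)^-1 <= l -> p.[(q_ q)^-1] <= 0.
  move=> ql; rewrite pE subr_le0.
  have qk : 0 < q_ q ^+ k by rewrite exprn_gt0 // q_gt0.
  rewrite -(ler_pM2r qk) -mulrA mulr_suml.
  pose X := \bigcup_(i in I) grid q (c i) (c i + const_mx l).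
  have fX : finite_set X by apply: bigcup_finite.
  apply: (@le_trans _ _ (cnt X)%:R).
    apply: (cnt_lbr (Y := fun i => grid q (c i) (c i + const_mx l))) => //.
    - by rewrite mulr_ge0 ?exprn_ge0 ?subr_ge0 // ltW // q_gt0.
    - by move=> i Ii z; exists i.
    - by move=> i j z Ii Ij; exact: disj.
    - by move=> i _; exact: grid_lb.
  have : (cnt X <= \sum_(ab <- bs) cnt (grid q ab.1 ab.2))%N.
    apply: (cnt_bigcup_seq (Y := fun ab => grid q ab.1 ab.2)) => //.
    by move=> z [i Ii]; exact: cov.
  rewrite -(ler_nat R) natr_sum => /le_trans; apply; apply: ler_sum => ab _.
  exact: grid_ub.
have p0 : p.[0] = (cnt I)%:R * l ^+ k - \sum_(ab <- bs) box_vol ab.1 ab.2.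
  by rewrite pE subr0; congr (_ - _); apply: eq_bigr => ab _; apply: eq_bigr => i _;
    rewrite addr0.
rewrite -subr_le0 -p0 leNgt; apply/negP => p0_gt.
have [|e e0 pe] := @poly_lt_near0 (- p) 0; first by rewrite hornerN oppr_lt0.
have [q qe] : exists q, (q_ q)^-1 <= Num.min e l.
  exists (Num.truncn (Num.min e l)^-1).
  have m0 : 0 < Num.min e l by rewrite lt_min e0.
  rewrite -[leRHS]invrK lef_pV2 ?posrE ?invr_gt0 ?q_gt0 // /q_ ltW //.
  exact: truncnS_gt.
move: qe; rewrite le_min => /andP[qe ql].
have := pe (q_ q)^-1; rewrite invr_gt0 q_gt0 qe hornerN oppr_lt0 => /(_ isT).
by rewrite ltNge pq.
Qed.

End Packing.

(** * Lebesgue outer measure and cubes *)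

Section Volume.
Variables (R : realType) (k : nat).
Implicit Types (x : 'rV[R]_k) (A K : set 'rV[R]_k).

Lemma rVD x y i : (x + y) ord0 i = x ord0 i + y ord0 i.
Proof. by rewrite mxE. Qed.

Lemma rVB x y i : (x - y) ord0 i = x ord0 i - y ord0 i.
Proof. by rewrite !mxE. Qed.

Lemma rVDc x (c : R) i : (x + const_mx c) ord0 i = x ord0 i + c.
Proof. by rewrite !mxE. Qed.

Lemma ball_rV x (e : R) (y : 'rV[R]_k) : 0 < e ->
  ball x e y <-> forall i, `|x ord0 i - y ord0 i| < e.
Proof.
move=> e0; split=> [[_ H] i|H]; first exact: H.
by split=> // i j; rewrite (ord1 i); exact: H.
Qed.

Lemma leb_vol_le A K : A `<=` K -> (leb_vol A <= leb_vol K)%E.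
Proof.
move=> AK; apply: le_ereal_inf_tmp => _ [ab /= Kab <-].
by apply: ereal_inf_lbound; exists ab => //=; exact: subset_trans Kab.
Qed.

Lemma leb_vol_ge0 A : (0 <= leb_vol A)%E.
Proof.
apply: le_ereal_inf_tmp => _ [ab /= Kab <-].
by apply: nneseries_ge0 => i _ _; rewrite lee_fin box_vol_ge0.
Qed.

Lemma box_vol_const (a : 'rV[R]_k) (l : R) : 0 <= l -> box_vol a (a + const_mx l) = l ^+ k.
Proof.
move=> l0; rewrite /box_vol -[X in _ ^+ X]card_ord -prodr_const.
by apply: eq_bigr => i _; rewrite !mxE addrAC subrr add0r; apply/max_idPr.
Qed.

(** The finite list is padded to a sequence by empty boxes; they have volume 0 because [k] is
    positive (the empty product would be 1). *)
Lemma leb_vol_le_seq A (bs : seq ('rV[R]_k * 'rV[R]_k)) : (0 < k)%N ->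
  (forall x, A x -> exists2 ab, ab \in bs & box ab.1 ab.2 x) ->
  (leb_vol A <= (\sum_(ab <- bs) box_vol ab.1 ab.2)%:E)%E.
Proof.
move=> k0 cov; pose f (j : nat) := nth (0, 0) bs j.
apply: (@le_trans _ _ (\sum_(0 <= j <oo) (box_vol (f j).1 (f j).2)%:E)%E).
  apply: ereal_inf_lbound; exists (fun j => (f j).1, fun j => (f j).2) => //=.
  move=> x /cov[ab abs bx]; exists (index ab bs) => //=.
  by rewrite /f nth_index.
rewrite (nneseries_split 0 (size bs)); last by move=> *; rewrite lee_fin box_vol_ge0.
rewrite add0n eseries0 ?adde0; last first.
  move=> i bi _; rewrite /f nth_default //; congr EFin.
  by rewrite /box_vol (bigD1 (Ordinal k0)) //= subrr maxxx mul0r.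
by rewrite sumEFin lee_fin (big_nth (0, 0)).
Qed.

(** Half-open boxes are not open; this makes covers by boxes accessible to compactness at an
    arbitrarily small cost in volume. *)
Lemma box_enlarge (a b : 'rV[R]_k) (e : R) : 0 < e -> exists ab : 'rV[R]_k * 'rV[R]_k,
  box a b `<=` (box ab.1 ab.2)^° /\ box_vol ab.1 ab.2 <= box_vol a b + e.
Proof.
move=> e0.
pose p : {poly R} := \prod_i ((Num.max 0 (b ord0 i - a ord0 i))%:P + 2%:P * 'X).
have pE d : p.[d] = \prod_i (Num.max 0 (b ord0 i - a ord0 i) + 2 * d).
  by rewrite horner_prod; apply: eq_bigr => i _; rewrite !hornerE.
have [|d d0 pd] := @poly_lt_near0 _ p (box_vol a b + e).
  rewrite pE (_ : \prod_i _ = box_vol a b) ?ltrDl //.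
  by apply: eq_bigr => i _; rewrite mulr0 addr0.
exists (a - const_mx d, b + const_mx d); split => /=.
  move=> x xab; apply/nbhs_ballP; exists d => //= y /(ball_rV _ _ d0) xy i.
  have := xy i; rewrite ltr_norml => /andP[y1 y2]; have [x1 x2] := xab i.
  rewrite !mxE; split; lra.
have := pd d; rewrite d0 lexx => /(_ isT)/ltW; apply: le_trans.
rewrite pE; apply: ler_prod => i _; rewrite le_max lexx /=.
rewrite !mxE ge_max; apply/andP; split.
  by rewrite addr_ge0 ?le_max ?lexx // mulr_ge0 // ltW.
have : b ord0 i - a ord0 i <= Num.max 0 (b ord0 i - a ord0 i) by rewrite le_max lexx orbT.
lra.
Qed.

(** Enlarge the j-th box of a cover by [e / 2 ^ j.+1] in volume, so that the interiors cover [K];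
    compactness keeps finitely many of them. *)
Lemma compact_outer K (v : R) : compact K -> (leb_vol K < v%:E)%E ->
  exists bs : seq ('rV[R]_k * 'rV[R]_k),
    (forall x, K x -> exists2 ab, ab \in bs & (box ab.1 ab.2)^° x) /\
    \sum_(ab <- bs) box_vol ab.1 ab.2 < v.
Proof.
move=> cK /ereal_inf_lt[_ [ab /= Kab <-]] Sv.
set S := (X in (X < _)%E) in Sv.
have S0 : (0 <= S)%E by apply: nneseries_ge0 => i _ _; rewrite lee_fin box_vol_ge0.
have [s sE] : exists s, S = s%:E.
  by case: S Sv S0 => [s|//|//]; exists s.
rewrite sE lte_fin in Sv.
(* Half of the available gap is spent on all enlargements together, so the total stays below [v]. *)
pose e := (v - s) / 2.
have e0 : 0 < e by rewrite divr_gt0 // subr_gt0.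
have en j : 0 < e / (2 ^ j.+1)%:R by rewrite divr_gt0 // ltr0n expn_gt0.
have [f fP] := choice (fun j => box_enlarge (ab.1 j) (ab.2 j) (en j)).
have [N _ NP] : \forall N \near \oo, K `<=` [set x | exists2 j, (j < N)%N & (box (f j).1
  (f j).2)^° x].
  apply: (proj1 (compact_near_coveringP K) cK) => x /Kab[j _ /(proj1 (fP j))] xj.
  exists ((box (f j).1 (f j).2)^°, [set N | (j < N)%N]) => /=.
    split; last by exists j.+1.
    by apply: open_nbhs_nbhs; split=> //; exact: open_interior.
  by move=> [y N] /= [yj jN]; exists j.
exists [seq f j | j <- iota 0 N]; split=> [x Kx|].
  have [|j jN xj] := NP N _ x Kx; first exact: leqnn.
  by exists (f j) => //; apply/map_f; rewrite mem_iota.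
rewrite big_map -lte_fin.
apply: (@le_lt_trans _ _ (s + e)%:E); last by rewrite lte_fin /e; lra.
have /= := @epsilon_trick R (fun j => (box_vol (ab.1 j) (ab.2 j))%:E) e xpredT.
rewrite -/S sE => H.
have {}H := H (fun j => ltac:(by rewrite lee_fin box_vol_ge0)) (ltW e0).
rewrite EFinD; apply: le_trans H.
apply: le_trans (nneseries_lim_ge N _); last first.
  by move=> j _ _; rewrite -EFinD lee_fin addr_ge0 ?box_vol_ge0 // ltW.
rewrite /index_iota subn0 -sumEFin; apply: lee_sum => j _.
by rewrite -EFinD lee_fin; exact: (proj2 (fP j)).
Qed.

(** * Cubes of a mesh: outer and inner Jordan approximation *)

Definition ccube (h : R) (a : 'rV[int]_k) : set 'rV[R]_k :=
  [set x | forall i, (a ord0 i)%:~R * h <= x ord0 i <= ((a ord0 i)%:~R + 1) * h].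

Definition outer (h : R) A : set 'rV[int]_k := [set a | ccube h a `&` A !=set0].
Definition inner (h : R) A : set 'rV[int]_k := [set a | ccube h a `<=` A].

Definition bounded_by (M : R) A := forall x, A x -> forall i, `|x ord0 i| <= M.

Lemma rV_norm_ge x i : `|x ord0 i| <= `|x|.
Proof.
rewrite [leRHS]/Num.norm /= mx_normrE.
by rewrite (le_trans _ (le_bigmax _ _ (ord0, i))).
Qed.

Lemma compact_bounded_by K : compact K -> exists2 M, 0 < M & bounded_by M K.
Proof.
move=> /compact_bounded[M [_ HM]]; exists (Num.max 1 (M + 1)).
  by rewrite lt_max ltr01.
move=> x Kx i.
have /= := HM (Num.max 1 (M + 1)) _ x Kx.
rewrite lt_max ltrDl ltr01 orbT => /(_ isT); apply: le_trans.
exact: rV_norm_ge.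
Qed.

Definition idx (h : R) x : 'rV[int]_k := \row_i Num.floor (x ord0 i / h).

Lemma ccube_idx (h : R) x : 0 < h -> ccube h (idx h x) x.
Proof.
move=> h0 i; rewrite mxE; have /andP[h1 h2] := floor_itv (x ord0 i / h).
move: h1 h2; rewrite ler_pdivlMr // ltr_pdivrMr // intrD => -> /ltW ->//.
Qed.

Lemma outer_finite h M A : 0 < h -> bounded_by M A -> finite_set (outer h A).
Proof.
move=> h0 AM.
have : finite_set (int_box (fun=> - Num.ceil (M / h) - 1) (fun _ : 'I_k => (2 * `|Num.ceil
  (M / h)| + 3)%N)).
  exact: (proj1 (int_box_cnt _ _)).
apply: sub_finite_set => a [x [xa /AM xM]] i.
have /andP[h1 h2] := xa i; have := xM i; rewrite ler_norml => /andP[h3 h4].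
have M0 : 0 <= M by have := xM i; apply: le_trans.
have c0 : 0 <= Num.ceil (M / h).
  by rewrite ceil_ge0; apply: lt_le_trans (divr_ge0 M0 (ltW h0)).
rewrite PoszD PoszM gez0_abs //.
have a1 : a ord0 i <= Num.ceil (M / h).
  rewrite -(ler_int R); apply: le_trans (ceil_ge _); rewrite ler_pdivlMr //.
  exact: le_trans h4.
have a2 : - (a ord0 i + 1) <= Num.ceil (M / h).
  rewrite -(ler_int R); apply: le_trans (ceil_ge _); rewrite ler_pdivlMr //.
  by rewrite rmorphN /= intrD mulNr lerNl; exact: le_trans h2.
by apply/andP; split; lra.
Qed.

Lemma inner_outer h A : 0 < h -> inner h A `<=` outer h A.
Proof.
move=> h0 a aA; exists (\row_i ((a ord0 i)%:~R * h)).
have H : ccube h a (\row_i ((a ord0 i)%:~R * h)).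
  by move=> i; rewrite mxE lexx /= mulrDl mul1r lerDl ltW.
by split=> //; exact: aA.
Qed.

(** The index of the cube containing [x] is the floor of (x - o) / h in every coordinate. The offset
    and the shorter side admit cubes that are shrunk inside their mesh cell. *)
Lemma box_cube_inj (h o l : R) (a b : 'rV[int]_k) x : 0 < h -> l <= h ->
  box (\row_i ((a ord0 i)%:~R * h + o)) (\row_i ((a ord0 i)%:~R * h + o) + const_mx l) x ->
  box (\row_i ((b ord0 i)%:~R * h + o)) (\row_i ((b ord0 i)%:~R * h + o) + const_mx l) x ->
  a = b.
Proof.
move=> h0 lh xa xb; apply/rowP => i.
have H (c : 'rV[int]_k) :
  box (\row_i ((c ord0 i)%:~R * h + o)) (\row_i ((c ord0 i)%:~R * h + o) + const_mx l) x ->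
  Num.floor ((x ord0 i - o) / h) = c ord0 i.
  move=> /(_ i); rewrite !mxE => -[c1 c2]; apply: floor_def.
  by rewrite ler_pdivlMr // ltr_pdivrMr // intrD mulrDl mul1r; lra.
by rewrite -(H _ xa) -(H _ xb).
Qed.

Lemma leb_vol_le_outer h A : (0 < k)%N -> 0 < h -> finite_set (outer h A) ->
  (leb_vol A <= ((cnt (outer h A))%:R * h ^+ k)%:E)%E.
Proof.
move=> k0 h0 fA.
pose c (a : 'rV[int]_k) : 'rV[R]_k := \row_i ((a ord0 i)%:~R * h).
pose bs := [seq (c z, c z + const_mx h) | z <- fset_set (outer h A)].
have -> : (cnt (outer h A))%:R * h ^+ k = \sum_(ab <- bs) box_vol ab.1 ab.2.
  rewrite big_map (eq_bigr (fun=> h ^+ k)) => [|z _]; last exact/box_vol_const/ltW.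
  by rewrite big_const_seq count_predT iter_addr_0 mulr_natl.
apply: leb_vol_le_seq => // x Ax.
have xo : outer h A (idx h x) by exists x; split=> //; exact: ccube_idx.
exists (c (idx h x), c (idx h x) + const_mx h).
  by apply/map_f; rewrite in_fset_set // inE.
move=> i /=; rewrite !mxE; have /andP[h1 h2] := floor_itv (x ord0 i / h).
by move: h1 h2; rewrite ler_pdivlMr // ltr_pdivrMr // intrD mulrDl mul1r.
Qed.

(* For a compact set the packing of the cubes meeting it stays inside a
   finite cover by slightly enlarged boxes. *)
Lemma outer_compact K (v : R) : compact K -> (leb_vol K < v%:E)%E ->
  exists2 h0, 0 < h0 & forall h, 0 < h <= h0 -> (cnt (outer h K))%:R * h ^+ k < v.
Proof.
move=> cK /(compact_outer cK)[bs [Kbs bsv]].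
have [M M0 KM] := compact_bounded_by cK.
(* A Lebesgue number: one [e] for which all [e]-balls centred in [K] stay inside the finite cover.
   Mesh cubes of side at most [e / 4] that meet [K] lie in such balls. *)
have : \forall e \near 0^'+, K `<=` [set x | forall y, ball x e y -> exists2 ab, ab \in
  bs & box ab.1 ab.2 y].
  apply: (proj1 (compact_near_coveringP K) cK) => x /Kbs[ab abs /nbhs_ballP[e /= e0 xe]].
  exists (ball x (e / 2), [set d | d < e / 2]) => /=.
    split; first by apply: nbhsx_ballx; rewrite divr_gt0.
    by apply: nbhs_right_lt; rewrite divr_gt0.
  move=> [x' d] /= [xx' de] y x'y; exists ab => //; apply: xe.
  rewrite (splitr e); apply: ball_triangle xx' _.
  by apply: le_ball x'y; exact: ltW.
move=> /(filterI (nbhs_right_gt 0))/filter_ex[e [/= e0 He]].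
exists (e / 4); first by rewrite divr_gt0.
move=> h /andP[h0 he]; apply: le_lt_trans bsv.
apply: (packing (c := fun a : 'rV[int]_k => \row_i ((a ord0 i)%:~R * h + 0))) => //.
- exact: outer_finite KM.
- by move=> a b x _ _; apply: box_cube_inj.
- move=> a x [y [ya Ky]] xa; apply: (He y Ky); apply/ball_rV => // i.
  have /andP[y1 y2] := ya i; have := xa i; rewrite !mxE => -[x1 x2].
  by rewrite ltr_norml; apply/andP; split; lra.
Qed.

(** The union of the closed cubes is compact, so a countable cover of too small a volume would yield
    a finite one, contradicting [packing]. *)
Lemma leb_vol_ge_cubes (I : set 'rV[int]_k) (h l o : R) A :
  0 < l <= h -> finite_set I ->
  (forall a x, I a ->
    (forall i, (a ord0 i)%:~R * h + o <= x ord0 i <= (a ord0 i)%:~R * h + o + l) -> A x) ->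
  (((cnt I)%:R * l ^+ k)%:E <= leb_vol A)%E.
Proof.
move=> /andP[l0 lh] fI IA.
pose C (a : 'rV[int]_k) : set 'rV[R]_k :=
  [set x | forall i, `[(a ord0 i)%:~R * h + o, (a ord0 i)%:~R * h + o + l]%classic
    (x ord0 i)].
have cC a : compact (C a).
  apply: (@rV_compact R k (fun i => `[(a ord0 i)%:~R * h + o,
    (a ord0 i)%:~R * h + o + l]%classic)).
  by move=> i; exact: segment_compact.
pose K := \bigcup_(a in I) C a.
have cK : compact K.
  rewrite /K -(bigsetU_fset_set _ fI); elim/big_ind : _ => //.
  - exact: compact0.
  - by move=> *; apply: compactU.
have KA : K `<=` A.
  by move=> x [a Ia Cx]; apply: IA Ia _ => i; have := Cx i; rewrite /= in_itv.
apply: le_trans (leb_vol_le KA); rewrite leNgt; apply/negP.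
move=> /(compact_outer cK)[bs [Kbs]]; apply/negP; rewrite -leNgt.
apply: (packing (c := fun a : 'rV[int]_k => \row_i ((a ord0 i)%:~R * h + o))) => //.
- by move=> a b x _ _; apply: box_cube_inj => //; exact: lt_le_trans lh.
- move=> a x Ia xa; have [|ab abs xab] := Kbs x.
    exists a => // i; have := xa i; rewrite !mxE /= in_itv /= => -[-> /ltW].
    by [].
  by exists ab => //; exact: interior_subset xab.
Qed.

Lemma leb_vol_ge_inner h A : 0 < h -> finite_set (inner h A) ->
  (((cnt (inner h A))%:R * h ^+ k)%:E <= leb_vol A)%E.
Proof.
move=> h0 fA; apply: (@leb_vol_ge_cubes _ h h 0); rewrite ?h0 ?lexx //.
move=> a x aA xa; apply: aA => i; have := xa i.
by rewrite addr0 mulrDl mul1r.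
Qed.

Lemma leb_vol_fin A M : (0 < k)%N -> bounded_by M A -> leb_vol A \is a fin_num.
Proof.
move=> k0 /(outer_finite ltr01) /(leb_vol_le_outer k0 ltr01) H.
by rewrite ge0_fin_numE ?leb_vol_ge0 //; apply: le_lt_trans H _; rewrite ltry.
Qed.

(** Affine images of covers are covers. Only one inequality is shown; the other follows by applying
    it to the inverse map. *)
Lemma leb_vol_affine A (l : R) (u : 'rV[R]_k) : 0 < l ->
  (leb_vol [set (u + l *: x)%R | x in A] <= (l ^+ k)%:E * leb_vol A)%E.
Proof.
move=> l0; rewrite -lee_pdivrMl ?exprn_gt0 //.
apply: le_ereal_inf_tmp => _ [ab /= Kab <-].
rewrite lee_pdivrMl ?exprn_gt0 // -nneseriesZl; last first.
  by move=> i _; rewrite lee_fin box_vol_ge0.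
apply: ereal_inf_lbound.
exists (fun j => u + l *: ab.1 j, fun j => u + l *: ab.2 j) => /=.
  move=> _ [x Ax <-]; have [j _ bj] := Kab x Ax; exists j => // i.
  have [b1 b2] := bj i; rewrite !mxE lerD2l ltrD2l.
  by rewrite ler_pM2l // ltr_pM2l.
congr (limn _); apply/funext => N; apply: eq_bigr => j _.
rewrite -EFinM; congr EFin; rewrite /box_vol.
rewrite -[X in l ^+ X]card_ord -prodr_const -big_split /=.
apply: eq_bigr => i _; rewrite !mxE.
by rewrite maxr_pMr ?(ltW l0) // mulr0; congr Num.max; ring.
Qed.

Lemma leb_vol_translate A (u : 'rV[R]_k) : leb_vol [set u + x | x in A] = leb_vol A.
Proof.
have H (B : set 'rV[R]_k) (v : 'rV[R]_k) : (leb_vol [set (v + x)%R | x in B] <= leb_vol B)%E.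
  have := @leb_vol_affine B 1 v ltr01; rewrite expr1n mul1e.
  by rewrite (_ : [set _ | x in B] = [set v + x | x in B]) //; apply/seteqP;
    split=> _ [x Bx <-]; exists x; rewrite ?scale1r.
apply/eqP; rewrite eq_le H /=.
rewrite {1}(_ : A = [set - u + x | x in [set u + x | x in A]]) ?H //.
apply/seteqP; split=> [x Ax|_ [_ [x Ax <-] <-]]; last by rewrite addKr.
by exists (u + x); rewrite ?addKr //; exists x.
Qed.

End Volume.

(** * Euclidean balls *)

Section EuclideanBall.
Variables (R : realType) (n : nat).
Hypothesis n_gt0 : (0 < n)%N.
Implicit Types (x y : 'rV[R]_n).

Let sq x := \sum_(i < n) x ord0 i ^+ 2.

Lemma eballP (r : R) x : 0 < r -> @eball R n r x <-> sq x < r ^+ 2.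
Proof.
move=> r0; rewrite /eball /= -{1}[r]gtr0_norm // -sqrtr_sqr ltr_sqrt //.
by rewrite exprn_gt0.
Qed.

(* [2 x y <= (C/r) x^2 + (r/C) y^2], summed over the coordinates. *)
Lemma eballD (r d : R) x y : 0 < r -> 0 < d -> @eball R n r x ->
  (forall i, `|y ord0 i| <= d) -> @eball R n (r + n%:R * d) (x + y).
Proof.
move=> r0 d0 /(eballP _ r0) xr yd.
have n0 : 1 <= n%:R :> R by rewrite ler1n.
set C := n%:R * d; have C0 : 0 < C by rewrite mulr_gt0 // (lt_le_trans _ n0).
apply/eballP; first by rewrite addr_gt0.
(* The sharp Euclidean bound is sqrt(n) d; the cruder n d avoids a square root, as n <= n^2. *)
have yC : sq y <= C ^+ 2.
  apply: (@le_trans _ _ (\sum_(i < n) d ^+ 2)).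
    apply: ler_sum => i _; rewrite -real_normK ?num_real //.
    by rewrite ler_pXn2r ?nnegrE // ltW.
  rewrite sumr_const card_ord -mulr_natl /C exprMn ler_wpM2r ?sqr_ge0 //.
  by rewrite expr2 ler_peMr // (le_trans _ n0).
apply: (@le_lt_trans _ _ (sq x * (1 + C / r) + sq y * (1 + r / C))).
  rewrite !mulr_suml -big_split /=; apply: ler_sum => i _; rewrite mxE -subr_ge0.
  have -> : x ord0 i ^+ 2 * (1 + C / r) + y ord0 i ^+ 2 * (1 + r / C) -
    (x ord0 i + y ord0 i) ^+ 2 = (C * x ord0 i - r * y ord0 i) ^+ 2 / (r * C).
    by field; rewrite !gt_eqF.
  by rewrite divr_ge0 ?sqr_ge0 // mulr_ge0 // ltW.
have -> : (r + C) ^+ 2 = r ^+ 2 * (1 + C / r) + C ^+ 2 * (1 + r / C).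
  by field; rewrite !gt_eqF.
apply: ltr_leD; first by rewrite ltr_pM2r // addr_gt0 // divr_gt0.
by rewrite ler_wpM2r // addr_ge0 // divr_ge0 // ltW.
Qed.

Lemma eball_bounded (r : R) : 0 < r -> bounded_by r (@eball R n r).
Proof.
move=> r0 x /(eballP _ r0) xr i.
rewrite -(@ler_pXn2r _ 2) ?nnegrE // ?(ltW r0) // real_normK ?num_real //.
apply: le_trans (ltW xr); rewrite /sq (bigD1 i) //= lerDl.
by apply: sumr_ge0 => j _; exact: sqr_ge0.
Qed.

Definition unit_ball_vol : R := fine (leb_vol (@eball R n 1)).

Let V1E : leb_vol (@eball R n 1) = unit_ball_vol%:E.
Proof. by rewrite fineK // (leb_vol_fin n_gt0 (eball_bounded ltr01)). Qed.

Let eballZ (r l : R) : 0 < r -> 0 < l ->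
  @eball R n (l * r) = [set 0 + l *: x | x in @eball R n r].
Proof.
move=> r0 l0.
have sqZ c x : sq (c *: x) = c ^+ 2 * sq x.
  by rewrite mulr_sumr; apply: eq_bigr => i _; rewrite mxE exprMn.
apply/seteqP; split=> [x|_ [x + <-]].
  move=> /(eballP _ (mulr_gt0 l0 r0)) xr; exists (l^-1 *: x); last first.
    by rewrite add0r scalerA mulfV ?scale1r // gt_eqF.
  apply/eballP => //; rewrite sqZ exprVn mulrC ltr_pdivrMr ?exprn_gt0 //.
  by rewrite -exprMn mulrC.
move=> /(eballP _ r0) xr; apply/eballP; first exact: mulr_gt0.
by rewrite add0r sqZ exprMn ltr_pM2l // exprn_gt0.
Qed.

Lemma eball_vol (r : R) : 0 < r -> leb_vol (@eball R n r) = (r ^+ n * unit_ball_vol)%:E.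
Proof.
move=> r0; apply/eqP; rewrite eq_le; apply/andP; split.
  by rewrite EFinM -V1E -{1}[r]mulr1 eballZ //; exact: leb_vol_affine.
have := @leb_vol_affine R n (@eball R n r) r^-1 0; rewrite invr_gt0 => /(_ r0).
rewrite -eballZ ?invr_gt0 // mulVf ?gt_eqF // V1E exprVn.
by rewrite muleC lee_pdivlMr ?exprn_gt0 // -EFinM mulrC.
Qed.

Lemma unit_ball_vol_gt0 : 0 < unit_ball_vol.
Proof.
have n0 : 0 < n%:R :> R by rewrite ltr0n.
rewrite -lte_fin -V1E.
(* A single cube of side 1/(2n) at the origin fits into the unit ball: by [eballD] it lies in the
   ball of radius 1/2 + n/(2n). *)
apply: lt_le_trans (_ : (((cnt [set (0 : 'rV[int]_n)])%:R * (n%:R * 2)^-1 ^+ n)%:E <= _)%E).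
  rewrite /cnt fset_set1 cardfs1 mul1r lte_fin exprn_gt0 // invr_gt0 mulr_gt0 //.
apply: (@leb_vol_ge_cubes _ _ _ (n%:R * 2)^-1 _ 0) => //.
  by rewrite lexx invr_gt0 mulr_gt0.
move=> a x /= -> H.
have -> : 1 = 2^-1 + n%:R * (n%:R * 2)^-1 :> R by field; rewrite gt_eqF.
rewrite -[x]add0r; apply: eballD; rewrite ?invr_gt0 ?mulr_gt0 //.
  apply/eballP; first by rewrite invr_gt0.
  by rewrite /sq big1 ?exprn_gt0 ?invr_gt0 // => i _; rewrite mxE expr0n.
by move=> i; have := H i; rewrite mxE mul0r !add0r => /andP[x0 xl]; rewrite ger0_norm.
Qed.

Lemma eball_cube_near (r s : R) (a : 'rV[int]_n) x y : 0 < r -> 0 < s ->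
  @eball R n r x -> ccube s a x -> ccube s a y -> @eball R n (r + n%:R * s) y.
Proof.
move=> r0 s0 xr xa ya; rewrite -(subrKC x y); apply: eballD => // i.
have := xa i; have := ya i; rewrite !mxE mulrDl mul1r => /andP[? ?] /andP[? ?].
by rewrite ler_norml; apply/andP; split; lra.
Qed.

(** Cubes meeting the ball are contained in the ball of radius r + n s, so their total volume is at
    most that of the larger ball. *)
Lemma outer_eball (r s : R) : 0 < r -> 0 < s ->
  (cnt (outer s (@eball R n r)))%:R * s ^+ n <= (r + n%:R * s) ^+ n * unit_ball_vol.
Proof.
move=> r0 s0; have r'0 : 0 < r + n%:R * s by rewrite addr_gt0 // mulr_gt0 // ltr0n.
have f := outer_finite s0 (eball_bounded r'0).
have f' := sub_finite_set (@inner_outer _ _ s _ s0) f.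
rewrite -lee_fin -eball_vol //; apply: le_trans (leb_vol_ge_inner s0 f').
rewrite lee_fin ler_wpM2r ?exprn_ge0 ?(ltW s0) // ler_nat.
apply: cnt_le => // a [x [xa xr]] y ya; exact: eball_cube_near xr xa ya.
Qed.

(** Dually, the cubes meeting the ball of radius r - n s cover it and are contained in the ball of
    radius [r]. *)
Lemma inner_eball (r s : R) : 0 < s -> n%:R * s < r ->
  (r - n%:R * s) ^+ n * unit_ball_vol <= (cnt (inner s (@eball R n r)))%:R * s ^+ n.
Proof.
move=> s0 sr; have r'0 : 0 < r - n%:R * s by rewrite subr_gt0.
have r0 : 0 < r by apply: le_lt_trans sr; rewrite mulr_ge0 // ltW.
have f := outer_finite s0 (eball_bounded r0).
have f' := sub_finite_set (@inner_outer _ _ s _ s0) f.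
have f2 := outer_finite s0 (eball_bounded r'0).
rewrite -lee_fin -eball_vol //; apply: le_trans (leb_vol_le_outer n_gt0 s0 f2) _.
rewrite lee_fin ler_wpM2r ?exprn_ge0 ?(ltW s0) // ler_nat.
apply: cnt_le => // a [x [xa xr]] y ya.
by rewrite -(subrK (n%:R * s) r); exact: eball_cube_near xr xa ya.
Qed.

End EuclideanBall.

(** * Windows and covariograms *)

Section Window.
Variables (R : realType) (m : nat).
Hypothesis m_gt0 : (0 < m)%N.
Implicit Types (W : set 'rV[R]_m) (x y p q : 'rV[R]_m).

(** Otherwise [W] and its interior would have the same trace on the segment, a nonempty clopen
    subset, hence by connectedness all of it, including [q]. *)
Lemma segment_meets_boundary W p q : closed W -> W p -> ~ W q ->
  exists2 s : R, 0 <= s <= 1 & (W `\` W^°) (p + s *: (q - p)).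
Proof.
move=> cW Wp Wq; apply: contrapT => nb.
pose f (s : R) := p + s *: (q - p).
have cf : continuous f.
  by move=> s; apply: cvgD; [exact: cvg_cst|apply: cvgZl; exact: cvg_id].
have E : `[0, 1]%classic `&` f @^-1` W = `[0, 1]%classic `&` f @^-1` (W^°).
  apply/seteqP; split=> s [s01 Ws]; split=> //; last exact: interior_subset Ws.
  apply: contrapT => nWs; apply: nb; exists s => //.
have c01 : connected (`[0, 1]%classic : set R) by exact: segment_connected.
have B : `[0, 1]%classic `&` f @^-1` W = `[0, 1]%classic.
  apply: c01.
  - by exists 0; split; rewrite /= ?in_itv /= ?lexx ?ler01 // /f scale0r addr0.
  - exists (f @^-1` (W^°)) => //.
    by apply: open_comp => [? _|]; [exact: cf|exact: open_interior].
  - by exists (f @^-1` W) => //; apply: closed_comp => // ? _; exact: cf.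
have : `[0, 1]%classic (1 : R) by rewrite /= in_itv /= ler01 lexx.
by rewrite -B => -[_]; rewrite /f /= scale1r subrKC.
Qed.

Lemma ccube_convex (h s : R) (a : 'rV[int]_m) x y : 0 <= s <= 1 ->
  ccube h a x -> ccube h a y -> ccube h a (x + s *: (y - x)).
Proof.
move=> /andP[s0 s1] xa ya i; rewrite !mxE.
have /andP[x1 x2] := xa i; have /andP[y1 y2] := ya i.
by apply/andP; split; nra.
Qed.

Definition covset W y := W `&` [set y + x | x in W].

Lemma covsetE W y x : covset W y x <-> W x /\ W (x - y).
Proof.
split=> [[Wx [z Wz zx]]|[Wx Wxy]]; first by split=> //; rewrite -zx [y + z]addrC addrK.
by split=> //; exists (x - y); rewrite // subrKC.
Qed.

Variables (W : set 'rV[R]_m) (hW : window W).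

Lemma window_closed : closed W.
Proof. by have [cW _ _ _] := hW; apply: compact_closed cW; exact: norm_hausdorff. Qed.

Let bd := W `\` W^°.

Let bd_vol : leb_vol bd = 0%E.
Proof. by have [_ _ _] := hW; rewrite -(proj1 (closure_id _) window_closed). Qed.

Lemma translate_compact (A : set 'rV[R]_m) y : compact A -> compact [set y + x | x in A].
Proof.
move=> cA; apply: continuous_compact cA; apply: continuous_subspaceT => x.
by apply: (@continuousD _ _ _ (fun=> y) id); [exact: cst_continuous|exact: cvg_id].
Qed.

Lemma covset_compact y : compact (covset W y).
Proof.
have [cW _ _ _] := hW; apply: compact_closedI => //.
by apply: compact_closed; [exact: norm_hausdorff|exact: translate_compact].
Qed.

Let bd_compact : compact bd.
Proof.
have [cW _ _ _] := hW; rewrite /bd setDE; apply: compact_closedI => //.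
by apply: open_closedC; exact: open_interior.
Qed.

Definition covol y : R := fine (covariogram W y).

Lemma covolE y : covariogram W y = (covol y)%:E.
Proof.
rewrite /covol fineK //; have [M M0 KM] := compact_bounded_by (@covset_compact y).
exact: (leb_vol_fin m_gt0 KM).
Qed.

(** A cube that meets the intersection without being contained in it has a point outside [W] or
    outside y + W. A segment inside the cube then crosses the boundary of [W] or its translate. *)
Lemma outer_covset h y : 0 < h ->
  outer h (covset W y) `<=`
  inner h (covset W y) `|` (outer h bd `|` outer h [set y + x | x in bd]).
Proof.
move=> h0 a [p [pa /covsetE[Wp Wpy]]].
have [|nI] := pselect (inner h (covset W y) a); [by left|right].
have [q qa nq] : exists2 q, ccube h a q & ~ covset W y q.
  by apply: contrapT => H; apply: nI => q qa; apply: contrapT => H2; apply: H; exists q.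
have [Wq|nWq] := pselect (W q); last first.
  left; have [s s01 sb] := segment_meets_boundary window_closed Wp nWq.
  by exists (p + s *: (q - p)); split=> //; exact: ccube_convex.
right; have nWqy : ~ W (q - y) by move=> H; apply: nq; apply/covsetE.
have [s s01 sb] := segment_meets_boundary window_closed Wpy nWqy.
exists (p + s *: (q - p)); split; first exact: ccube_convex.
exists (p - y + s *: (q - y - (p - y))) => //.
have -> : q - y - (p - y) = q - p by rewrite opprB addrA subrK.
by rewrite addrA subrKC.
Qed.

(** The intersection is Jordan measurable: cubes that are outer but not inner meet one of two
    compact null sets, and on a fine mesh these cubes have total volume below [e]. *)
Lemma covset_jordan y (e : R) : 0 < e -> exists2 h0, 0 < h0 &
  forall h, 0 < h <= h0 ->
    (cnt (outer h (covset W y)))%:R * h ^+ m < covol y + e /\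
    covol y - e < (cnt (inner h (covset W y)))%:R * h ^+ m.
Proof.
move=> e0; have e20 : 0 < e / 2 by rewrite divr_gt0.
have [|h1 h10 H1] := @outer_compact _ _ (covset W y) (covol y + e) (@covset_compact y).
  by rewrite -[leb_vol _]/(covariogram W y) covolE lte_fin ltrDl.
have [|h2 h20 H2] := @outer_compact _ _ bd (e / 2) bd_compact.
  by rewrite bd_vol lte_fin.
have [|h3 h30 H3] := @outer_compact _ _ _ (e / 2) (@translate_compact _ y bd_compact).
  by rewrite leb_vol_translate bd_vol lte_fin.
exists (Num.min h1 (Num.min h2 h3)); first by rewrite !lt_min h10 h20.
move=> h; rewrite !le_min => /and4P[h0 hh1 hh2 hh3].
have {H1} H1 := H1 h; rewrite h0 hh1 in H1; have {}H1 := H1 isT.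
have {H2} H2 := H2 h; rewrite h0 hh2 in H2; have {}H2 := H2 isT.
have {H3} H3 := H3 h; rewrite h0 hh3 in H3; have {}H3 := H3 isT.
split=> //.
have [M1 _ K1] := compact_bounded_by (@covset_compact y).
have [M2 _ K2] := compact_bounded_by bd_compact.
have [M3 _ K3] := compact_bounded_by (@translate_compact _ y bd_compact).
have f1 := outer_finite h0 K1; have f2 := outer_finite h0 K2.
have f3 := outer_finite h0 K3.
have fi := sub_finite_set (@inner_outer _ _ h (covset W y) h0) f1.
have f23 : finite_set (outer h bd `|` outer h [set y + x | x in bd]) by rewrite finite_setU.
have := leq_trans (cntU_le fi f23 (@outer_covset h y h0)) (leq_add (leqnn _)
  (cntU_le f2 f3 (@subset_refl _ _))).
rewrite -(ler_nat R) !natrD => Hc.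
have := leb_vol_le_outer m_gt0 h0 f1.
rewrite -[leb_vol _]/(covariogram W y) covolE lee_fin => Hv.
have hm : 0 <= h ^+ m by rewrite exprn_ge0 // ltW.
have := ler_wpM2r hm Hc; rewrite !mulrDl; lra.
Qed.

(** * Continuity of the covariogram *)

Lemma covol_usc y (e : R) : 0 < e -> \forall y' \near y, covol y' < covol y + e.
Proof.
move=> e0; have [|bs [Kbs bse]] := @compact_outer _ _ (covset W y) (covol y + e)
  (@covset_compact y).
  by rewrite -[leb_vol _]/(covariogram W y) covolE lte_fin ltrDl.
have [cW _ _ _] := hW.
have : \forall y' \near y, W `<=` [set x | W
  (x - y') -> exists2 ab, ab \in bs & box ab.1 ab.2 x].
  apply: (proj1 (compact_near_coveringP W) cW _ (nbhs y)
    (fun y' x => W (x - y') -> exists2 ab, ab \in bs & box ab.1 ab.2 x)) => x Wx.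
  have [Wxy|nWxy] := pselect (W (x - y)).
    have [|ab abs xab] := Kbs x; first exact/covsetE.
    exists ((box ab.1 ab.2)^°, setT) => /=.
      split; last exact: filterT.
      by apply: open_nbhs_nbhs; split=> //; exact: open_interior.
    by move=> [x' y'] /= [x'ab _] _; exists ab => //; exact: interior_subset x'ab.
  (* When x - y is outside the closed set [W], nearby differences stay outside too, so the covering
     condition holds vacuously. *)
  have xyW : nbhs (x - y) (~` W).
    by apply: open_nbhs_nbhs; split=> //; apply: closed_openC; exact: window_closed.
  have /(_ _ xyW)[[P Q] /= [xP yQ] PQ] := @sub_continuous 'rV[R]_m (x, y).
  by exists (P, Q) => // -[x' y'] /= H Wx'; have := PQ (x', y') H.
apply: filterS => y' Hy'; rewrite -lte_fin -covolE.
apply: le_lt_trans (_ : (_ <= (\sum_(ab <- bs) box_vol ab.1 ab.2)%:E)%E) _;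
  last by rewrite lte_fin.
by apply: leb_vol_le_seq => // x /covsetE[Wx Wxy]; exact: Hy'.
Qed.

(** Shrink the inner cubes by [d'] on every side. They remain inside the intersection for every [y']
    closer to [y] than [d'], and lose little volume. *)
Lemma covol_lsc y (e : R) : 0 < e -> \forall y' \near y, covol y - e < covol y'.
Proof.
move=> e0; have [h h0 /(_ h)] := covset_jordan y e0; rewrite h0 lexx => /(_ isT)[_ Hi].
set I := inner h (covset W y) in Hi *.
have [M _ KM] := compact_bounded_by (@covset_compact y).
have fI : finite_set I := sub_finite_set (@inner_outer _ _ h (covset W y) h0)
  (outer_finite h0 KM).
pose p : {poly R} := - ((cnt I)%:R%:P * (h%:P - 2%:P * 'X) ^+ m).
have pE d : p.[d] = - ((cnt I)%:R * (h - 2 * d) ^+ m) by rewrite /p !hornerE.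
have [|d d0 pd] := @poly_lt_near0 _ p (- (covol y - e)).
  by rewrite pE mulr0 subr0 ltrN2.
pose d' := Num.min d (h / 4).
have d'0 : 0 < d' by rewrite lt_min d0 divr_gt0.
have d'h : 2 * d' < h.
  have : d' <= h / 4 by rewrite ge_min lexx orbT.
  lra.
have := pd d'; rewrite d'0 ge_min lexx => /(_ isT); rewrite pE ltrN2 => H.
apply/nbhs_ballP; exists d' => //= y' /(ball_rV _ _ d'0) yy'.
rewrite -lte_fin -covolE; apply: lt_le_trans (_ : (((cnt I)%:R *
  (h - 2 * d') ^+ m)%:E <= _)%E).
  by rewrite lte_fin.
apply: (@leb_vol_ge_cubes _ _ _ h _ d') => //; first by lra.
move=> a x aI xa; apply/covsetE; split.
  have /covsetE[] // : covset W y x.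
  by apply: aI => i; have /andP[x1 x2] := xa i; apply/andP; split; lra.
have /covsetE[_] : covset W y (x - y' + y).
  apply: aI => i; have /andP[x1 x2] := xa i; rewrite !mxE.
  by have := yy' i; rewrite ltr_norml => /andP[y1 y2]; apply/andP; split; lra.
by rewrite addrK.
Qed.

Lemma covol_continuous : continuous covol.
Proof.
move=> y; apply/(cvgrPdist_lt (FF := nbhs_filter y)) => e e0.
apply: (filterS2 _ _ (covol_usc y e0) (covol_lsc y e0)) => y' h1 h2.
by rewrite ltr_norml; apply/andP; split; lra.
Qed.

End Window.

(** * The lattice *)

Section Lattice.
Variables (R : realType) (n m : nat) (B : 'M[R]_(n + m)).
Hypothesis hB : cut_project_scheme B.
Local Notation idxT := 'rV[int]_(n + m).

(** Lattice points are handled through their integer coordinates, a type on which finite counting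
    and translation are direct. *)
Definition emb (z : idxT) : 'rV[R]_(n + m) := map_mx (fun k : int => k%:~R) z *m B.
Definition direct (z : idxT) : 'rV[R]_n := lsubmx (emb z).
Definition internal (z : idxT) : 'rV[R]_m := rsubmx (emb z).

Lemma embD z w : emb (z + w) = emb z + emb w.
Proof. by rewrite /emb -mulmxDl; congr (_ *m _); apply/rowP => i; rewrite !mxE intrD. Qed.

Lemma embB z w : emb (z - w) = emb z - emb w.
Proof. by rewrite /emb -mulmxBl; congr (_ *m _); apply/rowP => i; rewrite !mxE rmorphB. Qed.

Lemma directD z w : direct (z + w) = direct z + direct w.
Proof. by rewrite /direct embD raddfD. Qed.
Lemma directB z w : direct (z - w) = direct z - direct w.
Proof. by rewrite /direct embB raddfB. Qed.
Lemma internalD z w : internal (z + w) = internal z + internal w.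
Proof. by rewrite /internal embD raddfD. Qed.
Lemma internalB z w : internal (z - w) = internal z - internal w.
Proof. by rewrite /internal embB raddfB. Qed.

Let B_unit : B \in unitmx. Proof. by have [] := hB. Qed.

Lemma emb_inj : injective emb.
Proof.
move=> z w /(congr1 (mulmx^~ (invmx B))); rewrite /emb !mulmxK // => /rowP e.
by apply/rowP => i; have := e i; rewrite !mxE => /intr_inj.
Qed.

Lemma direct_inj : injective direct.
Proof.
have [_ inj _] := hB; move=> z w /inj H; apply: emb_inj; apply: H.
  by exists z.
by exists w.
Qed.

Lemma mulmx_bound k l (A : 'M[R]_(k, l)) : exists2 C, 0 < C &
  forall (x : 'rV[R]_k) (M : R), 0 <= M -> (forall i, `|x ord0 i| <= M) ->
    forall j, `|(x *m A) ord0 j| <= C * M.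
Proof.
exists (1 + \sum_i \sum_j `|A i j|).
  by rewrite ltr_pwDl // sumr_ge0 // => i _; rewrite sumr_ge0.
move=> x M M0 xM j; rewrite mxE.
apply: (le_trans (ler_norm_sum _ _ _)).
apply: (@le_trans _ _ (\sum_i (\sum_j `|A i j|) * M)).
  apply: ler_sum => i _; rewrite normrM mulrC ler_pM //.
  by rewrite (bigD1 j) //= lerDl sumr_ge0.
by rewrite -mulr_suml ler_wpM2r ?lerDr.
Qed.

Lemma emb_bound (x1 : 'rV[R]_n) (x2 : 'rV[R]_m) M :
  (forall i, `|x1 ord0 i| <= M) -> (forall i, `|x2 ord0 i| <= M) ->
  forall i, `|row_mx x1 x2 ord0 i| <= M.
Proof.
by move=> h1 h2 i; case: (split_ordP i) => j ->; rewrite ?row_mxEl ?row_mxEr.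
Qed.

Definition latset (T : set 'rV[R]_n) (A : set 'rV[R]_m) : set idxT :=
  [set z | T (direct z) /\ A (internal z)].

(** Multiplying by the inverse of [B] bounds the integer coordinates of lattice points in a bounded
    region. *)
Lemma latset_finite T A M1 M2 : bounded_by M1 T -> bounded_by M2 A ->
  finite_set (latset T A).
Proof.
move=> TM AM; have [C C0 CP] := mulmx_bound (invmx B).
pose M := Num.max 0 (Num.max M1 M2).
pose L := Num.ceil (C * M).
have : finite_set (int_box (fun=> - L) (fun _ : 'I_(n + m) => (`|L| + `|L| + 1)%N)).
  exact: (proj1 (int_box_cnt _ _)).
apply: sub_finite_set => z [zT zA] i.
have : `|(z ord0 i)%:~R| <= C * M :> R.
  have -> : (z ord0 i)%:~R = (row_mx (direct z) (internal z) *m invmx B) ord0 i :> R.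
    by rewrite hsubmxK /emb mulmxK // mxE.
  apply: CP; first by rewrite le_max lexx.
  apply: emb_bound => j.
    by rewrite (le_trans (TM _ zT j)) // !le_max lexx orbT.
  by rewrite (le_trans (AM _ zA j)) // !le_max lexx !orbT.
move=> /le_trans/(_ (ceil_ge _)); rewrite -/L -intr_norm ler_int.
have := normr_ge0 (z ord0 i) => z0 zL.
have L0 : 0 <= L by exact: le_trans zL.
move: zL; rewrite ler_norml => /andP[h1 h2].
by rewrite h1 !PoszD gez0_abs //=; lra.
Qed.

(** Round the coordinates of the target with respect to [B] down to integers; the error has
    coordinates in [0, 1) and [B] maps it to a bounded vector. *)
Lemma lattice_cocompact : exists2 M, 0 < M & forall (u1 : 'rV[R]_n) (u2 : 'rV[R]_m),
  exists z, (forall i, `|direct z ord0 i - u1 ord0 i| <= M) /\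
            (forall i, `|internal z ord0 i - u2 ord0 i| <= M).
Proof.
have [C C0 CP] := mulmx_bound B; exists C => // u1 u2.
pose w := row_mx u1 u2 *m invmx B.
pose z : idxT := \row_i Num.floor (w ord0 i).
have E : emb z - row_mx u1 u2 = (map_mx (fun k : int => k%:~R) z - w) *m B.
  by rewrite mulmxBl mulmxKV.
have H i : `|(emb z - row_mx u1 u2) ord0 i| <= C.
  rewrite E -[C]mulr1; apply: CP => // j; rewrite !mxE.
  have /andP[h1 h2] := floor_itv (w ord0 j); move: h2; rewrite intrD => h2.
  by rewrite -/w ler_norml; apply/andP; split; move: h1 h2; rewrite !mxE; lra.
exists z; split=> i.
  have := H (lshift m i); rewrite -[emb z]hsubmxK.
  by rewrite mxE [(- _ : 'rV__) _ _]mxE !row_mxEl.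
have := H (rshift n i); rewrite -[emb z]hsubmxK.
by rewrite mxE [(- _ : 'rV__) _ _]mxE !row_mxEr.
Qed.
End Lattice.

(** * Equidistribution of lattice points *)

Section Equidistribution.
Variables (R : realType) (n m : nat) (B : 'M[R]_(n + m)).
Hypothesis hB : cut_project_scheme B.
Local Notation direct := (direct B).
Local Notation internal := (internal B).
Local Notation latset := (latset B).

(** Cocompactness leaves an internal residue in the cube [-M, M]^m. Density corrects it up to [e],
    and compactness of that cube bounds the direct parts of the corrections uniformly. *)
Lemma lattice_approx (e : R) : 0 < e -> exists2 C, 0 < C &
  forall (u1 : 'rV[R]_n) (u2 : 'rV[R]_m), exists z,
    (forall i, `|direct z ord0 i - u1 ord0 i| <= C) /\
    (forall i, `|internal z ord0 i - u2 ord0 i| <= e).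
Proof.
move=> e0; have [M M0 MP] := lattice_cocompact hB.
pose Q : set 'rV[R]_m := [set v | forall i, `[- M, M]%classic (v ord0 i)].
have cQ : compact Q.
  by apply: (@rV_compact R m (fun=> `[- M, M]%classic)) => _; exact: segment_compact.
have : \forall C \near +oo, Q `<=` [set v | exists z,
    (forall i, `|direct z ord0 i| <= C) /\ forall i, `|internal z ord0 i - v ord0 i| <= e].
  apply: (proj1 (compact_near_coveringP Q) cQ _ (pinfty_nbhs R) (fun C v => exists z,
    (forall i, `|direct z ord0 i| <= C) /\
    forall i, `|internal z ord0 i - v ord0 i| <= e)) => v _.
  have e20 : 0 < e / 2 by rewrite divr_gt0.
  have [_ _ dB] := hB.
  have [||u [vu [_ [z _ <-] xE]]] := dB (ball v (e / 2)).
  - by exists v; exact: ballxx.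
  - exact: ball_open.
  have vx : ball v (e / 2) (internal z) by rewrite /internal /emb xE.
  exists (ball v (e / 2), [set C | `|direct z| <= C]) => /=.
    split; first exact: nbhsx_ballx.
    exact: nbhs_pinfty_ge.
  move=> [v' C] /= [vv' zC]; exists z; split=> i.
    exact: le_trans (rV_norm_ge _ _) zC.
  move/(ball_rV _ _ e20): vv' => /(_ i); move/(ball_rV _ _ e20): vx => /(_ i).
  rewrite !ltr_norml => /andP[? ?] /andP[? ?].
  by rewrite ler_norml; apply/andP; split; lra.
move=> /(filterI (nbhs_pinfty_gt (num_real (0 : R))))/filter_ex[C [/= C0 CP]].
exists (C + M); first by rewrite addr_gt0.
move=> u1 u2; have [z1 [z1d z1i]] := MP u1 u2.
have [|z2 [z2d z2i]] := CP (u2 - internal z1).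
  move=> i /=; rewrite in_itv /= rVB; have := z1i i; rewrite ler_norml.
  by move=> /andP[? ?]; apply/andP; split; lra.
exists (z1 + z2); split=> i.
  rewrite directD rVD; have := z2d i; have := z1d i.
  rewrite !ler_norml => /andP[? ?] /andP[? ?]; apply/andP; split; lra.
rewrite internalD rVD; have := z2i i; rewrite rVB.
by congr (`|_| <= _); ring.
Qed.

Definition cell (s h : R) (x1 : 'rV[R]_n) (x2 : 'rV[R]_m) :=
  latset (box x1 (x1 + const_mx s)) (box x2 (x2 + const_mx h)).

Lemma box_bounded k (a b : 'rV[R]_k) : exists M, bounded_by M (box a b).
Proof.
exists (`|a| + `|b|) => x xab i; have [h1 h2] := xab i.
have := rV_norm_ge a i; have := rV_norm_ge b i.
have := normr_ge0 a; have := normr_ge0 b.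
rewrite !ler_norml => ? ? /andP[? ?] /andP[? ?]; apply/andP; split; lra.
Qed.

Lemma cell_finite s h x1 x2 : finite_set (cell s h x1 x2).
Proof.
have [M1 b1] := box_bounded x1 (x1 + const_mx s).
have [M2 b2] := box_bounded x2 (x2 + const_mx h).
exact: (latset_finite hB b1 b2).
Qed.

(* Translating by a lattice vector moves any cell into any slightly larger one. *)
Lemma cell_compare (e : R) : 0 < e -> exists2 C, 0 < C &
  forall s h x1 x2 y1 y2,
    (cnt (cell s h x1 x2) <= cnt (cell (s + 2 * C) (h + 2 * e) y1 y2))%N.
Proof.
move=> e0; have [C C0 CP] := lattice_approx e0; exists C => // s h x1 x2 y1 y2.
(* Aiming at an offset of [C] (resp. [e]) from the new corner turns errors of either sign into
   displacements in [0, 2C] (resp. [0, 2e]). *)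
have [z [zd zi]] := CP (y1 - x1 + const_mx C) (y2 - x2 + const_mx e).
apply: (proj2 (@cnt_inj _ _ _ _ (fun w => w + z) (@addIr _ z) (@cell_finite _ _ _ _) _)).
move=> w [wd wi]; split=> i.
  rewrite directD; have [h1 h2] := wd i; have := zd i.
  by rewrite !(rVDc, rVB, rVD) in h1 h2 *; rewrite ler_norml => /andP[? ?]; split; lra.
rewrite internalD; have [h1 h2] := wi i; have := zi i.
by rewrite !(rVDc, rVB, rVD) in h1 h2 *; rewrite ler_norml => /andP[? ?]; split; lra.
Qed.

(** The summand 0 puts these corners in the form of [box_cube_inj] with zero offset. *)
Let corner k (h : R) (a : 'rV[int]_k) : 'rV[R]_k := \row_i ((a ord0 i)%:~R * h + 0).

Lemma latset_ub T A M1 M2 (s h v : R) : bounded_by M1 T -> bounded_by M2 A ->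
  0 < s -> 0 < h -> (forall x1 x2, (cnt (cell s h x1 x2))%:R <= v) ->
  (cnt (latset T A))%:R <= (cnt (outer s T))%:R * (cnt (outer h A))%:R * v.
Proof.
move=> bT bA s0 h0 cv.
have fT := outer_finite s0 bT; have fA := outer_finite h0 bA.
rewrite -natrM -cnt_setX //.
apply: (cnt_ubr (Y := fun ab => cell s h (corner s ab.1) (corner h ab.2))).
- exact: le_trans (cv 0 0).
- exact: finite_setX.
- exact: (latset_finite hB bT bA).
- have idxP k (l : R) (x : 'rV[R]_k) : 0 < l -> box (corner l (idx l x)) (corner l
  (idx l x) + const_mx l) x.
    move=> l0 i; rewrite !mxE; have /andP[h1 h2] := floor_itv (x ord0 i / l).
    by move: h1 h2; rewrite ler_pdivlMr // ltr_pdivrMr // intrD addr0 mulrDl mul1r.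
  move=> z [zT zA]; exists (idx s (direct z), idx h (internal z)); last by split; exact: idxP.
  by split; [exists (direct z)|exists (internal z)]; split=> //; exact: ccube_idx.
- move=> ab _; apply: le_trans (cv (corner s ab.1) (corner h ab.2)).
  by rewrite ler_nat; apply: cnt_le; [exact: cell_finite|exact: subIsetr].
Qed.

Lemma latset_lb T A M1 M2 (s h v : R) : bounded_by M1 T -> bounded_by M2 A ->
  0 < s -> 0 < h -> 0 <= v -> (forall x1 x2, v <= (cnt (cell s h x1 x2))%:R) ->
  (cnt (inner s T))%:R * (cnt (inner h A))%:R * v <= (cnt (latset T A))%:R.
Proof.
move=> bT bA s0 h0 v0 cv.
have fT : finite_set (inner s T).
  exact: sub_finite_set (@inner_outer _ _ s _ s0) (outer_finite s0 bT).
have fA : finite_set (inner h A).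
  exact: sub_finite_set (@inner_outer _ _ h _ h0) (outer_finite h0 bA).
rewrite -natrM -cnt_setX //.
have boxP k (l : R) (a : 'rV[int]_k) x : box (corner l a)
  (corner l a + const_mx l) x -> ccube l a x.
  move=> xa i; have := xa i; rewrite !mxE addr0 mulrDl mul1r => -[-> /ltW].
  by [].
apply: (cnt_lbr (Y := fun ab => cell s h (corner s ab.1) (corner h ab.2))) => //.
- exact: finite_setX.
- exact: (latset_finite hB bT bA).
- move=> [a b] [/= aT bA'] z [zT zA].
  by split; [apply: aT|apply: bA']; exact: boxP.
- move=> [a b] [a' b'] z _ _ [/= z1 z2] [/= z3 z4]; congr pair.
    exact: box_cube_inj z1 z3.
  exact: box_cube_inj z2 z4.
Qed.

(** * Density of the lattice *)

Let dset : set R := [set t | exists s h v,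
  [/\ 0 < s, 0 < h, (forall x1 x2, (cnt (cell s h x1 x2))%:R <= v)
    & t = v / (s ^+ n * h ^+ m)]].

(** The best normalised upper bound valid for all cells of some size; it will also dominate all
    normalised uniform lower bounds. *)
Definition density : R := inf dset.

Let ccbox k (S : R) : set 'rV[R]_k := [set x | forall i, 0 <= x ord0 i <= S].

Let ccbox_bounded (k : nat) (S : R) : bounded_by S (@ccbox k S).
Proof. by move=> x xS i; have /andP[x0 xS'] := xS i; rewrite ger0_norm. Qed.

Let outer_ccbox k (s S : R) : 0 < s -> 0 <= S ->
  (cnt (outer s (@ccbox k S)))%:R <= (S / s + 2) ^+ k.
Proof.
move=> s0 S0.
have Ss0 : 0 <= S / s by rewrite divr_ge0 // ltW.
(* Closed mesh cubes touching the face at 0 have index -1, so the indices run from -1 to the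
   truncation of S / s. *)
have [f c] := int_box_cnt (fun=> -1) (fun _ : 'I_k => (Num.truncn (S / s) + 2)%N).
apply: (@le_trans _ _ ((Num.truncn (S / s) + 2)%N ^ k)%:R).
  rewrite ler_nat; move: c; rewrite prod_nat_const card_ord => <-; apply: cnt_le => //.
  move=> a [x [xa xS]] i; have /andP[h1 h2] := xa i; have /andP[h3 h4] := xS i.
  apply/andP; split.
    rewrite -subr_ge0 opprK -(ler_int R) intrD.
    by rewrite -(pmulr_lge0 _ s0) (le_trans h3).
  have -> : -1 + (Num.truncn (S / s) + 2)%N%:Z = (Num.truncn (S / s)).+1%:Z.
    by rewrite -addn1 !PoszD; ring.
  rewrite -(ltr_int R).
  apply: le_lt_trans (truncnS_gt (S / s)); rewrite ler_pdivlMr //.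
  exact: le_trans h1 _.
rewrite natrX lerXn2r ?nnegrE ?addr_ge0 // natrD lerD2r.
by rewrite truncn_le.
Qed.

Let inner_ccbox k (s : R) (N : nat) : 0 < s ->
  (N ^ k <= cnt (inner s (@ccbox k (N%:R * s))))%N.
Proof.
move=> s0.
have [f c] := int_box_cnt (fun=> 0) (fun _ : 'I_k => N).
move: c; rewrite prod_nat_const card_ord => <-; apply: cnt_le.
  by apply: sub_finite_set (@inner_outer _ _ s _ s0) (outer_finite s0 (@ccbox_bounded _ _)).
move=> a aN x xa i; have /andP[a0 a1] := aN i; have /andP[h1 h2] := xa i.
apply/andP; split; first by apply: le_trans h1; rewrite mulr_ge0 ?ler0z // ltW.
apply: le_trans h2 _; rewrite ler_pM2r //.
by rewrite add0r in a1; rewrite -(intrD _ _ 1) -[N%:R]/(N%:Z%:~R) ler_int -ltzD1 ltrD2r.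
Qed.


Let vol_gt0 (s h : R) : 0 < s -> 0 < h -> 0 < s ^+ n * h ^+ m.
Proof. by move=> s0 h0; rewrite mulr_gt0 // exprn_gt0. Qed.

Let dset_lb0 : lbound dset 0.
Proof.
move=> t [s [h [v [s0 h0 cv ->]]]]; rewrite divr_ge0 ?(ltW (vol_gt0 _ _)) //.
exact: le_trans (cv 0 0).
Qed.

Let dset_nonempty : dset !=set0.
Proof.
have [C C0 CP] := cell_compare (@ltr01 R).
exists ((cnt (cell (1 + 2 * C) (1 + 2 * 1) 0 0))%:R / (1 ^+ n * 1 ^+ m)).
by exists 1, 1, (cnt (cell (1 + 2 * C) (1 + 2 * 1) 0 0))%:R; split=> // *; rewrite ler_nat.
Qed.

Lemma density_le (s h v : R) : 0 < s -> 0 < h ->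
  (forall x1 x2, (cnt (cell s h x1 x2))%:R <= v) -> density * (s ^+ n * h ^+ m) <= v.
Proof.
move=> s0 h0 cv; rewrite -ler_pdivlMr ?vol_gt0 //; apply: ge_inf.
  by exists 0; exact: dset_lb0.
by exists s, h, v.
Qed.

(* Subdividing a large box both into (s, h)-cells and into (s', h')-cells
   compares every lower bound with every upper bound, as in Fekete's lemma. *)
Lemma density_ge (s h v : R) : 0 < s -> 0 < h -> 0 <= v ->
  (forall x1 x2, v <= (cnt (cell s h x1 x2))%:R) -> v <= density * (s ^+ n * h ^+ m).
Proof.
move=> s0 h0 v0 cv; rewrite -ler_pdivrMr ?vol_gt0 //.
apply: lb_le_inf; first exact: dset_nonempty.
move=> _ [s' [h' [v' [s'0 h'0 cv' ->]]]].
rewrite ler_pdivrMr ?vol_gt0 //.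
(* For a box of sides N s and N h, [p] at 1/N is the upper bound from (s', h')-cells divided by
   N^(n+m); boundary cells disappear as N grows. *)
pose p : {poly R} := v'%:P * (((s / s')%:P + 2%:P * 'X) ^+ n *
  ((h / h')%:P + 2%:P * 'X) ^+ m).
have pE e : p.[e] = v' * ((s / s' + 2 * e) ^+ n * (h / h' + 2 * e) ^+ m).
  by rewrite /p !hornerE.
have -> : v' / (s' ^+ n * h' ^+ m) * (s ^+ n * h ^+ m) = p.[0].
  rewrite pE mulr0 !addr0 !expr_div_n; field.
  by rewrite !expf_neq0 ?gt_eqF.
apply: poly_ge_harmonic => q; set N : R := q.+1%:R; rewrite pE.
have N0 : 0 < N by rewrite ltr0n.
have NN : 0 < N ^+ n * N ^+ m by apply: vol_gt0.
rewrite -(ler_pM2r NN).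
have H1 := latset_lb (@ccbox_bounded n (N * s)) (@ccbox_bounded m (N * h)) s0 h0 v0 cv.
have H2 := latset_ub (@ccbox_bounded n (N * s)) (@ccbox_bounded m (N * h)) s'0 h'0 cv'.
have Ns : 0 <= N * s by rewrite mulr_ge0 ?ltW.
have Nh : 0 <= N * h by rewrite mulr_ge0 ?ltW.
apply: (@le_trans _ _ ((cnt (inner s (@ccbox n (N * s))))%:R * (cnt (inner h (@ccbox m
  (N * h))))%:R * v)).
  rewrite mulrC ler_wpM2r // ler_pM ?exprn_ge0 ?(ltW N0) //.
    by rewrite -natrX ler_nat; exact: inner_ccbox.
  by rewrite -natrX ler_nat; exact: inner_ccbox.
apply: le_trans H1 _; apply: le_trans H2 _.
rewrite [leRHS]mulrC [leRHS]mulrCA mulrC ler_wpM2l //; first exact: le_trans (cv' 0 0).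
rewrite mulrACA -!exprMn.
apply: ler_pM => //.
  apply: le_trans (outer_ccbox _ s'0 Ns) _; rewrite le_eqVlt; apply/orP; left; apply/eqP.
  by congr (_ ^+ _); field; rewrite !gt_eqF.
apply: le_trans (outer_ccbox _ h'0 Nh) _; rewrite le_eqVlt; apply/orP; left; apply/eqP.
by congr (_ ^+ _); field; rewrite !gt_eqF.
Qed.

(** By [cell_compare] the count of one cell is a uniform lower bound for larger cells and a uniform
    upper bound for smaller ones; [density_ge] and [density_le] then apply. *)
Lemma cell_bounds (e : R) : 0 < e -> exists2 C, 0 < C &
  (forall s h x1 x2, 0 < s -> 0 < h ->
    (cnt (cell s h x1 x2))%:R <= density * ((s + 2 * C) ^+ n * (h + 2 * e) ^+ m)) /\
  (forall s h x1 x2, 2 * C < s -> 2 * e < h ->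
    density * ((s - 2 * C) ^+ n * (h - 2 * e) ^+ m) <= (cnt (cell s h x1 x2))%:R).
Proof.
move=> e0; have [C C0 CP] := cell_compare e0; exists C => //; split.
  move=> s h x1 x2 s0 h0; apply: density_ge => //.
  - by rewrite addr_gt0 // mulr_gt0.
  - by rewrite addr_gt0 // mulr_gt0.
  - by move=> y1 y2; rewrite ler_nat.
move=> s h x1 x2 s0 h0; apply: density_le; rewrite ?subr_gt0 // => y1 y2.
rewrite ler_nat; have := CP (s - 2 * C) (h - 2 * e) y1 y2 x1 x2.
by rewrite !subrK.
Qed.

Lemma density_gt0 : 0 < density.
Proof.
have [C C0 CP] := lattice_approx (@ltr01 R).
have s0 : 0 < 2 * C + 1 by rewrite addr_gt0 // mulr_gt0.
have := @density_ge (2 * C + 1) 3 1 s0 _ ler01.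
rewrite ltr0n => /(_ isT); set V := _ * 3 ^+ m => H.
have V0 : 0 < V by apply: vol_gt0.
rewrite -(pmulr_lgt0 _ V0); apply: lt_le_trans (H _) => // x1 x2.
(* Every cell contains a point: the errors land in [0, 2C] and [0, 2], inside the half-open sides 2C
   + 1 and 3. *)
have [z [zd zi]] := CP (x1 + const_mx C) (x2 + const_mx 1).
rewrite ler1n /cnt cardfs_gt0; apply/eqP => E.
have : z \in fset_set (cell (2 * C + 1) 3 x1 x2); last by rewrite E inE.
rewrite in_fset_set ?inE; last exact: cell_finite.
split=> i; rewrite rVDc.
  by have := zd i; rewrite rVDc ler_norml => /andP[? ?]; split; lra.
by have := zi i; rewrite rVDc ler_norml => /andP[? ?]; split; lra.
Qed.

End Equidistribution.

(** * Counting lattice points over balls *)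

Section ModelSetCount.
Variables (R : realType) (n m : nat) (B : 'M[R]_(n + m)).
Hypothesis n_gt0 : (0 < n)%N.
Hypothesis hB : cut_project_scheme B.
Variables (K : set 'rV[R]_m) (M g : R).
Hypothesis bK : bounded_by M K.
Hypothesis jK : forall e : R, 0 < e -> exists2 h0, 0 < h0 & forall h, 0 < h <= h0 ->
    (cnt (outer h K))%:R * h ^+ m < g + e /\ g - e < (cnt (inner h K))%:R * h ^+ m.
(** [T r] models an intersection of two translated balls, which differs from the centred ball only
    in a layer of fixed thickness [D]. *)
Variables (D : R) (T : R -> set 'rV[R]_n).
Hypothesis D_ge0 : 0 <= D.
Hypothesis T_lb : forall r, D < r -> @eball R n (r - D) `<=` T r.
Hypothesis T_ub : forall r, D < r -> T r `<=` @eball R n (r + D).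

Local Notation c := (density B).
Local Notation V := (@unit_ball_vol R n).

Let cV_gt0 : 0 < c * V.
Proof. by rewrite mulr_gt0 ?density_gt0 ?unit_ball_vol_gt0. Qed.

Let T_bounded r : D < r -> bounded_by (r + D) (T r).
Proof.
move=> Dr x /(T_ub Dr); apply: eball_bounded => //.
by rewrite ltr_wpDr // (le_lt_trans D_ge0).
Qed.

Let near_pinfty_poly (p : {poly R}) (X : R) : p.[0] < X -> \forall r \near +oo, p.[r^-1] < X.
Proof.
move=> /poly_lt_near0[e e0 He].
have := nbhs_pinfty_ge (num_real e^-1); apply: filterS => r er.
have r0 : 0 < r by apply: lt_le_trans er; rewrite invr_gt0.
by apply: He; rewrite invr_gt0 r0 /= -[e]invrK lef_pV2 ?posrE ?invr_gt0.
Qed.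

(** The parameters are fixed in turn: window mesh [h], internal slack [e], direct mesh [s], radius
    [r]. Each polynomial [p1], [p2], [p3] adds one error factor and keeps the bound below [X]. *)
Let latset_lt (X : R) : c * V * g < X ->
  \forall r \near +oo, (cnt (latset B (T r) K))%:R < X * r ^+ n.
Proof.
(* With this tolerance the bound g + e becomes exactly X / (c V). *)
move=> gX; have [|h h0 /(_ h)] := jK (e := X / (c * V) - g).
  by rewrite subr_gt0 ltr_pdivlMr // mulrC.
rewrite h0 lexx subrKC ltr_pdivlMr // => /(_ isT)[+ _].
set O : R := (cnt (outer h K))%:R => H1.
have O0 : 0 <= O by rewrite ler0n.
pose p1 : {poly R} := (O * (c * V))%:P * (h%:P + 2%:P * 'X) ^+ m.
have p1E x : p1.[x] = O * (c * V) * (h + 2 * x) ^+ m by rewrite /p1 !hornerE.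
have [|e e0 /(_ e)] := @poly_lt_near0 _ p1 X.
  by rewrite p1E mulr0 addr0 mulrAC.
rewrite e0 lexx p1E => /(_ isT) H2.
have [C C0 [Cub _]] := cell_bounds hB e0.
pose p2 : {poly R} := (O * (c * V) * (h + 2 * e) ^+ m)%:P * (1 + (2 * C)%:P * 'X) ^+ n.
have p2E x : p2.[x] = O * (c * V) * (h + 2 * e) ^+ m * (1 + 2 * C * x) ^+ n.
  by rewrite /p2 !hornerE.
have := @near_pinfty_poly p2 X; rewrite p2E mulr0 addr0 expr1n mulr1.
move=> /(_ H2)/(filterI (nbhs_pinfty_gt (num_real (0 : R))))/filter_ex[s [/= s0]].
rewrite p2E => H3.
pose p3 : {poly R} := (O * (c * V) * (h + 2 * e) ^+ m * (1 + 2 * C / s) ^+ n)%:P *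
   (1 + (D + n%:R * s)%:P * 'X) ^+ n.
have p3E x : p3.[x] = O * (c * V) * (h + 2 * e) ^+ m * (1 + 2 * C / s) ^+ n *
    (1 + (D + n%:R * s) * x) ^+ n.
  by rewrite /p3 !hornerE.
have := @near_pinfty_poly p3 X; rewrite p3E mulr0 addr0 expr1n mulr1.
move=> /(_ H3)/(filterI (nbhs_pinfty_gt (num_real D))).
apply: filterS => r [/= Dr]; rewrite p3E => H4.
have r0 : 0 < r by exact: le_lt_trans Dr.
have rn : 0 < r ^+ n by rewrite exprn_gt0.
have rD : 0 < r + D by rewrite ltr_wpDr.
rewrite -(ltr_pM2r rn) in H4; apply: le_lt_trans H4.
have bT := T_bounded Dr.
apply: le_trans (latset_ub hB bT bK s0 h0 (fun x1 x2 => Cub s h x1 x2 s0 h0)) _.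
have fO := outer_finite s0 (@eball_bounded R n _ rD).
have H5 : (cnt (outer s (T r)))%:R * s ^+ n <= (r + D + n%:R * s) ^+ n * V.
  apply: le_trans (outer_eball n_gt0 rD s0).
  rewrite ler_wpM2r ?exprn_ge0 ?(ltW s0) // ler_nat; apply: cnt_le => // a [x [xa xT]].
  by exists x; split=> //; exact: T_ub.
have sn : 0 < s ^+ n by rewrite exprn_gt0.
rewrite -ler_pdivlMr // in H5.
have F0 : 0 <= O * (c * ((s + 2 * C) ^+ n * (h + 2 * e) ^+ m)).
  rewrite !mulr_ge0 ?exprn_ge0 ?(ltW (density_gt0 _)) // addr_ge0 ?mulr_ge0 // ltW //.
rewrite -mulrA; apply: le_trans (ler_wpM2r F0 H5) _.
rewrite le_eqVlt; apply/orP; left; apply/eqP.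
have -> : s + 2 * C = s * (1 + 2 * C / s) by field; rewrite gt_eqF.
have -> : r + D + n%:R * s = r * (1 + (D + n%:R * s) / r) by field; rewrite gt_eqF.
rewrite !exprMn; field; rewrite gt_eqF //.
Qed.

(** The same choice of parameters with inner cubes; the polynomials are negated because
    [poly_lt_near0] provides upper bounds. *)
Let latset_gt (X : R) : X < c * V * g ->
  \forall r \near +oo, X * r ^+ n < (cnt (latset B (T r) K))%:R.
Proof.
move=> gX; have [|h h0 /(_ h)] := jK (e := g - X / (c * V)).
  by rewrite subr_gt0 ltr_pdivrMr // mulrC.
rewrite h0 lexx subKr ltr_pdivrMr // => /(_ isT)[_].
set O : R := (cnt (inner h K))%:R => H1.
have O0 : 0 <= O by rewrite ler0n.
pose p1 : {poly R} := - ((O * (c * V))%:P * (h%:P - 2%:P * 'X) ^+ m).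
have p1E x : p1.[x] = - (O * (c * V) * (h - 2 * x) ^+ m) by rewrite /p1 !hornerE.
have [|e1 e10 He1] := @poly_lt_near0 _ p1 (- X).
  by rewrite p1E mulr0 subr0 ltrN2 mulrAC.
(* The cap h / 4 keeps the shrunken side h - 2e positive, as the lower cell bound requires. *)
pose e := Num.min e1 (h / 4).
have e0 : 0 < e by rewrite lt_min e10 divr_gt0.
have eh : 2 * e < h.
  have : e <= h / 4 by rewrite ge_min lexx orbT.
  lra.
have := He1 e; rewrite e0 ge_min lexx p1E ltrN2 => /(_ isT) H2.
have [C C0 [_ Clb]] := cell_bounds hB e0.
pose p2 : {poly R} := - ((O * (c * V) * (h - 2 * e) ^+ m)%:P * (1 - (2 * C)%:P * 'X) ^+ n).
have p2E x : p2.[x] = - (O * (c * V) * (h - 2 * e) ^+ m * (1 - 2 * C * x) ^+ n).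
  by rewrite /p2 !hornerE.
have := @near_pinfty_poly p2 (- X); rewrite p2E mulr0 subr0 expr1n mulr1 ltrN2.
move=> /(_ H2)/(filterI (nbhs_pinfty_gt (num_real (2 * C))))/filter_ex[s [/= sC]].
rewrite p2E ltrN2 => H3.
have s0 : 0 < s by apply: lt_trans sC; rewrite mulr_gt0.
pose p3 : {poly R} := - ((O * (c * V) * (h - 2 * e) ^+ m * (1 - 2 * C / s) ^+ n)%:P *
   (1 - (D + n%:R * s)%:P * 'X) ^+ n).
have p3E x : p3.[x] = - (O * (c * V) * (h - 2 * e) ^+ m * (1 - 2 * C / s) ^+ n *
    (1 - (D + n%:R * s) * x) ^+ n).
  by rewrite /p3 !hornerE.
have := @near_pinfty_poly p3 (- X); rewrite p3E mulr0 subr0 expr1n mulr1 ltrN2.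
have ns0 : 0 <= n%:R * s by rewrite mulr_ge0 // ltW.
move=> /(_ H3)/(filterI (nbhs_pinfty_gt (num_real (D + n%:R * s)))).
apply: filterS => r [/= Dr']; rewrite p3E ltrN2 => H4.
have Dr : D < r by apply: le_lt_trans Dr'; rewrite lerDl.
have r0 : 0 < r by exact: le_lt_trans Dr.
have rn : 0 < r ^+ n by rewrite exprn_gt0.
rewrite -(ltr_pM2r rn) in H4; apply: lt_le_trans H4 _.
have bT := T_bounded Dr.
have v0 : 0 <= c * ((s - 2 * C) ^+ n * (h - 2 * e) ^+ m).
  by rewrite !mulr_ge0 ?exprn_ge0 ?(ltW (density_gt0 _)) // subr_ge0 ltW.
apply: le_trans (latset_lb hB bT bK s0 h0 v0 (fun x1 x2 => Clb s h x1 x2 sC eh)).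
have fI : finite_set (inner s (T r)).
  exact: sub_finite_set (@inner_outer _ _ s _ s0) (outer_finite s0 bT).
have rD : n%:R * s < r - D by rewrite ltrBrDl.
have H5 : (r - D - n%:R * s) ^+ n * V <= (cnt (inner s (T r)))%:R * s ^+ n.
  apply: le_trans (inner_eball n_gt0 s0 rD) _.
  rewrite ler_wpM2r ?exprn_ge0 ?(ltW s0) // ler_nat; apply: cnt_le => // a aB x xa.
  by apply: T_lb => //; exact: aB.
have sn : 0 < s ^+ n by rewrite exprn_gt0.
rewrite -ler_pdivrMr // in H5.
have F0 : 0 <= O * (c * ((s - 2 * C) ^+ n * (h - 2 * e) ^+ m)) by rewrite mulr_ge0.
rewrite -[leRHS]mulrA; apply: le_trans (ler_wpM2r F0 H5).
rewrite le_eqVlt; apply/orP; left; apply/eqP.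
have -> : s - 2 * C = s * (1 - 2 * C / s) by field; rewrite gt_eqF.
have -> : r - D - n%:R * s = r * (1 - (D + n%:R * s) / r) by field; rewrite gt_eqF.
rewrite !exprMn; field; rewrite gt_eqF //.
Qed.

Lemma latset_cvg :
  (cnt (latset B (T r) K))%:R / fine (leb_vol (@eball R n r)) @[r --> +oo] --> c * g.
Proof.
have V0 : 0 < V by exact: unit_ball_vol_gt0.
have cV : c * V * g = c * g * V by ring.
apply/cvgrPdist_lt => e e0; near=> r.
have r0 : 0 < r by near: r; exact: nbhs_pinfty_gt.
have rn : 0 < r ^+ n by rewrite exprn_gt0.
have H1 : (cnt (latset B (T r) K))%:R < (c * g + e) * V * r ^+ n.
  by near: r; apply: latset_lt; rewrite cV ltr_pM2r // ltrDl.
have H2 : (c * g - e) * V * r ^+ n < (cnt (latset B (T r) K))%:R.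
  by near: r; apply: latset_gt; rewrite cV ltr_pM2r // gtrBl.
rewrite eball_vol //= [r ^+ n * _]mulrC.
have Vr : 0 < V * r ^+ n by rewrite mulr_gt0.
rewrite -mulrA -ltr_pdivrMr // in H1; rewrite -mulrA -ltr_pdivlMr // in H2.
by rewrite ltr_norml; apply/andP; split; lra.
Unshelve. all: by end_near.
Qed.

End ModelSetCount.

(** * Autocorrelation of model sets *)

(* In dimension 0 every box has volume 1, so even the empty set has infinite
   outer measure. *)
Lemma leb_vol_dim0 (R : realType) (A : set 'rV[R]_0) : (1 <= leb_vol A)%E.
Proof.
apply: le_ereal_inf_tmp => _ [ab _ <-].
apply: le_trans (nneseries_lim_ge 1 _); last by move=> *; rewrite lee_fin box_vol_ge0.
by rewrite big_nat1 /box_vol big_ord0.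
Qed.

(** In dimension zero no set has outer measure 0, so the boundary condition of a window already
    excludes it. *)
Lemma window_dim_gt0 (R : realType) (m : nat) (W : set 'rV[R]_m) : window W -> (0 < m)%N.
Proof.
case: m W => [|//] W [_ _ _ vol0].
by have := leb_vol_dim0 (closure W `\` W^°); rewrite vol0 lee_fin ler10.
Qed.

(** With trivial direct space all lattice points have the same projection, against injectivity. *)
Lemma scheme_dim_gt0 (R : realType) (n m : nat) (B : 'M[R]_(n + m)) :
  cut_project_scheme B -> (0 < m)%N -> (0 < n)%N.
Proof.
case: n B => [|//] B hB m0.
have : const_mx 0 = const_mx 1 :> 'rV[int]_(0 + m).
  by apply: (direct_inj hB); apply/rowP => -[].
by move=> /rowP/(_ (Ordinal m0)); rewrite !mxE.
Qed.

Lemma fsbig_cnt (R : realType) (T : choiceType) (A S : set T) (a : R) : finite_set A ->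
  \sum_(z \in A) (if z \in S then a else 0) = a * (cnt (A `&` S))%:R.
Proof.
move=> fA; rewrite -fsbig_mkcondr fsbig_finite; last exact: finite_setIl.
by rewrite big_const_seq count_predT iter_addr_0 mulr_natr.
Qed.

Section Autocorrelation.
Variables (R : realType) (n m : nat) (B : 'M[R]_(n + m)).
Hypotheses (n_gt0 : (0 < n)%N) (m_gt0 : (0 < m)%N).
Hypothesis hB : cut_project_scheme B.
Local Notation idxT := 'rV[int]_(n + m).
Local Notation direct := (direct B).
Local Notation internal := (internal B).

(** A finite stock of lattice vectors outside which no difference contributes: the direct part is
    confined by the support of [f], the internal part by W - W. *)
Definition cutoff (M1 M2 : R) : set idxT :=
  latset B [set x | forall i, `|x ord0 i| <= M1] [set x | forall i, `|x ord0 i| <= M2].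

Lemma cutoff_finite M1 M2 : finite_set (cutoff M1 M2).
Proof. by apply: (@latset_finite _ _ _ _ hB _ _ M1 M2) => x. Qed.

Variables (W : set 'rV[R]_m) (hW : window W) (t : 'rV[R]_n).

Let A (r : R) : set idxT := [set z | @eball R n r (t + direct z) /\ W (internal z)].

Let Lam_ball r : model_set B t W `&` @eball R n r = [set t + direct z | z in A r].
Proof.
apply/seteqP; split=> [x [[_ [[z _ <-] Wz] <-] xr]|_ [z [zr Wz] <-]]; first by exists z.
by split=> //; exists (emb B z) => //; split=> //; exists z.
Qed.

Let eballN r x : @eball R n r (- x) = @eball R n r x.
Proof. by rewrite /eball /=; under eq_bigr do rewrite mxE sqrrN. Qed.

Let NLam_ball r :
  [set - x | x in model_set B t W] `&` @eball R n r = [set - (t + direct z) | z in A r].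
Proof.
apply/seteqP; split=> [_ [[_ [_ [[z _ <-] Wz] <-] <-] xr]|_ [z [zr Wz] <-]].
  by exists z => //; split=> //; rewrite -eballN.
split; last by rewrite eballN.
by exists (t + direct z) => //; exists (emb B z) => //; split=> //; exists z.
Qed.

Variable MW : R.
Hypothesis W_bounded : bounded_by MW W.

Let A_finite r : 0 < r -> finite_set (A r).
Proof.
move=> r0; apply: (@latset_finite _ _ _ _ hB [set x | @eball R n r (t + x)] W
  (r + `|t|) MW) => //.
move=> x /= xr i; rewrite -[x](addKr t).
rewrite (_ : (- t + (t + x)) ord0 i = (t + x) ord0 i - t ord0 i); last by rewrite !mxE; ring.
by rewrite (le_trans (ler_normB _ _)) // lerD ?rV_norm_ge // (eball_bounded r0 xr).
Qed.

Variables (f : 'rV[R]_n -> R) (M1 M2 : R).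
Hypothesis f_supp : forall x, f x != 0 -> forall i, `|x ord0 i| <= M1.
Hypothesis M2W : MW + MW <= M2.
Let E := cutoff M1 M2.

(** Substitute w = z - z'. Differences outside [E] may be dropped: their internal part is bounded
    through [W], so [f] must vanish at their direct part. *)
Let inner_sum r z : A r z ->
  \sum_(z' \in A r) f (direct (z - z')) =
  \sum_(w \in E) (if w \in [set w | A r (z - w)] then f (direct w) else 0).
Proof.
move=> [zr Wz]; rewrite -fsbig_mkcondr.
rewrite (@fsbig_widen _ _ _ _ (E `&` [set w | A r (z - w)]) [set w | A r (z - w)]);
  last 2 first.
  exact: subIsetr.
  move=> w [/= Aw nEw]; apply/eqP; apply: contrapT => /negP fw; apply: nEw; split=> //.
  split=> i /=; first exact: f_supp.
  have -> : internal w ord0 i = internal z ord0 i - internal (z - w) ord0 i.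
    by rewrite -rVB -internalB subKr.
  apply: le_trans (ler_normB _ _) _; apply: le_trans M2W; apply: lerD; apply: W_bounded => //.
  by case: Aw.
rewrite (@reindex_fsbig _ _ _ _ _ (fun w => z - w) [set w | A r (z - w)] (A r)).
  by apply: eq_fsbigr => w _; rewrite subKr.
split=> [w //|w w' _ _ /addrI/oppr_inj //|w Aw].
by exists (z - w) => /=; rewrite ?subKr.
Qed.

Let T w r : set 'rV[R]_n := [set x | @eball R n r (t + x) /\ @eball R n r (t +
  (x - direct w))].

(** Exchanging the sums groups the pairs by their difference [w]. The points z with z and z - w both
    admissible are the lattice points over [T w r] with internal part in the intersection of [W]
    with its translate. *)
Let autocorr_sum r : 0 < r -> autocorr_approx (model_set B t W) f r =
  \sum_(w <- fset_set E) f (direct w) *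
    ((cnt (latset B (T w r) (covset W (internal w))))%:R / fine (leb_vol (@eball R n r))).
Proof.
move=> r0; have fA := A_finite r0; have fE : finite_set E := cutoff_finite M1 M2.
rewrite /autocorr_approx Lam_ball NLam_ball.
have inj1 : injective (fun z => t + direct z).
  by move=> z w /addrI/(direct_inj hB).
rewrite fsbig_image; last by move=> z w _ _; exact: inj1.
under eq_fsbigr => z Az.
  rewrite fsbig_image; last by move=> z' w _ _ /oppr_inj/inj1.
  under eq_fsbigr => z' _.
    have -> : t + direct z - (t + direct z') = direct (z - z').
      by rewrite directB opprD addrACA subrr add0r.
    over.
  rewrite inner_sum; last exact: set_mem.
  over.
rewrite exchange_fsbig // fsbig_finite // mulr_suml; apply: eq_bigr => w _.
rewrite mulrA; congr (_ / _).
rewrite (eq_fsbigr (fun z => if z \in [set z | A r (z - w)] then f (direct w) else 0)).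
  rewrite fsbig_cnt //; congr (_ * (cnt _)%:R).
  apply/seteqP; split=> z; rewrite /A /latset /T /= directB internalB.
    by move=> [[h1 h2] [h3 h4]]; split=> //; exact/covsetE.
  by move=> [[h1 h2] /covsetE[h3 h4]].
by move=> z _; congr (if _ then _ else _); apply/idP/idP => /set_mem ?; apply/mem_set.
Qed.

Lemma autocorr_cvg : autocorr_approx (model_set B t W) f r @[r --> +oo] -->
  \sum_(w <- fset_set E) f (direct w) * (density B * covol W (internal w)).
Proof.
have cv : \sum_(w <- fset_set E) f (direct w) *
    ((cnt (latset B (T w r) (covset W (internal w))))%:R / fine (leb_vol (@eball R n r)))
  @[r --> +oo] --> \sum_(w <- fset_set E) f (direct w) * (density B * covol W (internal w)).
  apply: cvg_big => [|w _]; first exact: add_continuous.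
  apply: cvgMr.
  (* This bounds the coordinates of both translations [t] and [t - direct w]; the summand 1 makes it
     positive for [eballD]. *)
  pose d := `|t| + `|direct w| + 1.
  have d0 : 0 < d by rewrite ltr_wpDl // addr_ge0.
  have nd0 : 0 <= n%:R * d by rewrite mulr_ge0 // ltW.
  have td i : `|t ord0 i| <= d.
    by rewrite (le_trans (rV_norm_ge _ _)) // /d -addrA lerDl addr_ge0.
  have twd i : `|(t - direct w) ord0 i| <= d.
    rewrite (le_trans (rV_norm_ge _ _)) // (le_trans (ler_normB _ _)) //.
    by rewrite /d lerDl.
  have [M _ KM] := compact_bounded_by (@covset_compact _ _ _ hW (internal w)).
  apply: (latset_cvg n_gt0 hB KM (covset_jordan m_gt0 hW (internal w)) nd0 (T := T w)).
    move=> r dr x xr; have r'0 : 0 < r - n%:R * d by rewrite subr_gt0.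
    split; rewrite -(subrK (n%:R * d) r).
      by rewrite [t + x]addrC; exact: eballD.
    have -> : t + (x - direct w) = x + (t - direct w) by rewrite addrCA.
    exact: (eballD n_gt0 r'0 d0 xr twd).
  move=> r dr x [xr _]; rewrite -[x](addKr t) [- t + _]addrC; apply: eballD => //.
    exact: le_lt_trans nd0 dr.
  by move=> i; rewrite mxE normrN.
apply: cvg_trans cv; apply: near_eq_cvg; near=> r.
by rewrite autocorr_sum //; near: r; exact: nbhs_pinfty_gt.
Unshelve. all: by end_near.
Qed.

End Autocorrelation.

(** * Homometry *)

Section Bump.
Variables (R : realType) (n : nat).

(** Twice the positive part of e - |x - u|, written with an absolute value so that continuity is
    immediate. *)
Definition bump (u : 'rV[R]_n) (e : R) (x : 'rV[R]_n) : R :=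
  (e - `|x - u|) + `|e - `|x - u| |.

Lemma bump_center u e : 0 < e -> bump u e u != 0.
Proof. by move=> e0; rewrite /bump subrr normr0 subr0 gtr0_norm // gt_eqF // addr_gt0. Qed.

Lemma bump_far u e x : e <= `|x - u| -> bump u e x = 0.
Proof. by move=> ex; rewrite /bump ler0_norm ?subr_le0 // addrN. Qed.

Lemma bump_continuous u e : continuous (bump u e).
Proof.
have c0 : continuous (fun x : 'rV[R]_n => `|x - u|).
  move=> x; apply: (@continuous_comp _ _ _ (fun x : 'rV[R]_n => x - u) Num.norm).
    by apply: (@continuousB _ _ _ id (fun=> u)); [exact: cvg_id|exact: cst_continuous].
  exact: norm_continuous.
have c1 : continuous (fun x : 'rV[R]_n => e - `|x - u|).
  move=> x; apply: (@cvgB _ _ _ (nbhs x) (nbhs_filter x) (fun=> e) (fun x => `|x - u|));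
    last exact: c0.
  exact: cvg_cst.
move=> x; apply: (@cvgD _ _ _ (nbhs x) (nbhs_filter x) (fun x => e - `|x - u|));
  first exact: c1.
by apply: cvg_norm; exact: c1.
Qed.

Lemma bump_Cc u e : Cc (bump u e).
Proof.
split; first exact: bump_continuous.
pose Q : set 'rV[R]_n := [set x | forall i, `[u ord0 i - e, u ord0 i + e]%classic (x ord0 i)].
have cQ : compact Q.
  apply: (@rV_compact R n (fun i => `[u ord0 i - e, u ord0 i + e]%classic)) => i.
  exact: segment_compact.
have clQ : closed Q by apply: (compact_closed _ cQ); exact: norm_hausdorff.
apply: (subclosed_compact _ cQ); first exact: closed_closure.
rewrite [X in _ `<=` X](proj1 (closure_id Q) clQ); apply: closure_subset => x /= fx i /=.
have xe : `|x - u| < e by rewrite ltNge; apply/negP => /bump_far/eqP; apply/negP.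
have := le_lt_trans (rV_norm_ge (x - u) i) xe; rewrite rVB ltr_norml in_itv /=.
by move=> /andP[? ?]; apply/andP; split; lra.
Qed.

End Bump.

Lemma finite_gap (R : realType) (T : choiceType) (S : set T) (d : T -> R) :
  finite_set S -> (forall x, S x -> 0 < d x) ->
  exists2 e, 0 < e & forall x, S x -> e <= d x.
Proof.
move=> fS dS.
have H (s : seq T) : {in s, forall x, 0 < d x} ->
    exists2 e, 0 < e & {in s, forall x, e <= d x}.
  elim: s => [_|x s IH ds]; first by exists 1.
  have [|e e0 es] := IH; first by move=> y ys; apply: ds; rewrite inE ys orbT.
  exists (Num.min e (d x)); first by rewrite lt_min e0 ds ?inE ?eqxx.
  move=> y; rewrite inE ge_min => /orP[/eqP->|/es->//]; by rewrite lexx orbT.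
have [|e e0 es] := H (fset_set S).
  by move=> x; rewrite in_fset_set // => /set_mem/dS.
by exists e => // x Sx; apply: es; rewrite in_fset_set // inE.
Qed.

Lemma Cc_bounded (R : realType) (n : nat) (f : 'rV[R]_n -> R) : Cc f ->
  exists M, forall x, f x != 0 -> forall i, `|x ord0 i| <= M.
Proof.
move=> [_ /compact_bounded_by[M _ H]]; exists M => x fx; apply: H.
exact: subset_closure.
Qed.

Theorem theorem1 (R : realType) (n m : nat) (B : 'M[R]_(n + m))
  (hB : cut_project_scheme B)
  (W W' : set 'rV[R]_m) (hW : window W) (hW' : window W')
  (t t' : 'rV[R]_n) :
  homometric (model_set B t W) (model_set B t' W') <->
  (forall y : 'rV[R]_m, covariogram W y = covariogram W' y).
Proof.
have m0 := window_dim_gt0 hW; have n0 := scheme_dim_gt0 hB m0.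
have [M M_gt0 WM] : exists2 M, 0 < M & bounded_by M W.
  by have [cW _ _ _] := hW; exact: compact_bounded_by.
have [M' M'_gt0 WM'] : exists2 M, 0 < M & bounded_by M W'.
  by have [cW _ _ _] := hW'; exact: compact_bounded_by.
pose limit (f : 'rV[R]_n -> R) (V : set 'rV[R]_m) M1 M2 : R :=
  \sum_(w <- fset_set (cutoff B M1 M2)) f (direct B w) * (density B * covol V (internal B w)).
have cvgs (f : 'rV[R]_n -> R) (M1 M2 : R) :
  (forall x, f x != 0 -> forall i, `|x ord0 i| <= M1) ->
    M + M <= M2 -> M' + M' <= M2 ->
    autocorr_approx (model_set B t W) f r @[r --> +oo] --> limit f W M1 M2 /\
    autocorr_approx (model_set B t' W') f r @[r --> +oo] --> limit f W' M1 M2.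
  by move=> fM h h'; split; [exact: (autocorr_cvg n0 m0 hB hW t WM fM h)|
                             exact: (autocorr_cvg n0 m0 hB hW' t' WM' fM h')].
split=> [[gamma gammaP] y|WW']; last first.
  (* The limit for [W] serves as the common measure; the limit formula depends on the window only
     through its covariogram. *)
  exists (fun f => lim (autocorr_approx (model_set B t W) f r @[r --> +oo])) => f.
  move=> /Cc_bounded[M1 fM1].
  pose M2 := M + M + (M' + M').
  have [||h1 h2] := @cvgs f M1 M2 fM1.
  - by rewrite lerDl addr_ge0 // ltW.
  - by rewrite lerDr addr_ge0 // ltW.
  rewrite (cvg_lim _ h1) //; split=> //.
  suff -> : limit f W M1 M2 = limit f W' M1 M2 by [].
  by apply: eq_bigr => w _; rewrite /covol WW'.
rewrite (covolE m0 hW) (covolE m0 hW'); congr EFin; apply/eqP; rewrite -subr_eq0.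
apply: contrapT => /negP ny.
pose D x := covol W x - covol W' x.
have cD : continuous D.
  move=> x; apply: (@cvgB _ _ _ (nbhs x) (nbhs_filter x) (covol W) (covol W'));
    exact: covol_continuous.
(* The covariograms differ on an open set, which contains the internal part of some lattice point
   [w0] by density. *)
have oD : open [set x | D x != 0].
  apply: (@open_comp _ _ D [set z | z != 0]) => [x _|]; first exact: cD.
  exact: open_neq.
have [_ _ dB] := hB.
have [|x [/= Dx [_ [w0 _ <-] wx]]] := dB _ _ oD; first by exists y.
have {wx} wx : internal B w0 = x by [].
(* The support of a bump of radius at most 1 around [direct B w0] fits within [M1]; the last summand
   of [M2] puts [w0] itself into the cutoff. *)
pose M1 := `|direct B w0| + 1.
pose M2 := M + M + (M' + M') + `|internal B w0|.
pose S := cutoff B M1 M2 `\ w0.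
(* Injectivity of the direct projection separates [w0] from the finitely many other cutoff vectors,
   so a narrow bump vanishes at all of them. *)
have [||e1 e10 He1] := @finite_gap R _ S (fun w => `|direct B w - direct B w0|).
- exact/finite_setD/cutoff_finite.
- move=> w [_ ww0]; rewrite normr_gt0 subr_eq0; apply/eqP => /(direct_inj hB).
  exact: ww0.
pose e := Num.min 1 e1.
have e0 : 0 < e by rewrite lt_min ltr01.
pose f := bump (direct B w0) e.
have fM1 z : f z != 0 -> forall i, `|z ord0 i| <= M1.
  move=> fz i; apply: le_trans (rV_norm_ge _ _) _.
  have ze : `|z - direct B w0| < e by rewrite ltNge; apply/negP => /bump_far/eqP; apply/negP.
  rewrite -[z](subrK (direct B w0)) (le_trans (ler_normD _ _)) // /M1 addrC lerD2l.
  by apply: ltW (lt_le_trans ze _); rewrite ge_min lexx.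
have [||h1 h2] := @cvgs f M1 M2 fM1.
- by rewrite /M2 -addrA lerDl !addr_ge0 // ltW.
- by rewrite /M2 addrAC lerDr !addr_ge0 // ltW.
have [g1 g2] := gammaP f (bump_Cc _ _).
have E : limit f W M1 M2 = limit f W' M1 M2.
  rewrite -(cvg_unique _ g1 h1) //; exact: (cvg_unique _ g2 h2).
have w0S : w0 \in fset_set (cutoff B M1 M2).
  rewrite in_fset_set; last exact: cutoff_finite.
  rewrite inE; split=> i /=; apply: le_trans (rV_norm_ge _ _) _; first by rewrite lerDl.
  by rewrite lerDr !addr_ge0 // ltW.
have L V : limit f V M1 M2 = f (direct B w0) * (density B * covol V (internal B w0)).
  rewrite /limit (big_fsetD1 w0) //= big_seq big1 ?addr0 // => w.
  rewrite in_fsetD1 in_fset_set; last exact: cutoff_finite.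
  move=> /andP[ww0 /set_mem wc]; rewrite /f bump_far ?mul0r //.
  rewrite ge_min; apply/orP; right; apply: He1; split=> // /eqP; exact/negP.
(* Cancelling the nonzero bump value and the positive density equates the covariograms at
   [internal B w0], a contradiction. *)
move: E; rewrite !L => /(mulfI (bump_center _ e0))/(mulfI _) E.
by move: Dx; rewrite /D -wx E ?subrr ?eqxx // gt_eqF // density_gt0.
Qed.
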